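(* Let $\lambda,\mu\in\mathbb{R}$. Then $\dim\mathrm{H}^1_{\mathrm{diff}}(\mathfrak{osp}(2|2),\mathfrak{osp}(1|2);\mathfrak{D}^2_{\lambda,\mu})\leq1$. It is $1$ only if $\lambda=\mu\neq0$ or $(\lambda,\mu)=(-\frac{k}{2},\frac{k}{2})$ with $k\in\mathbb{N}\setminus\{0\}$. The cohomology classes of the following 1-cocycles generate the corresponding spaces: $$\widetilde{\Upsilon}_{\lambda,\lambda}(X_G)=2\lambda\,\overline{\eta}_1(\partial_2(G))-(-1)^{|G|}\left(\partial_2(G)\,\overline{\eta}_1+\theta_2\,\overline{\eta}_2\overline{\eta}_1(G)\,\overline{\eta}_2\right)\qquad(\lambda=\mu\neq0),$$ $$\widetilde{\Upsilon}_{-\frac{k}{2},\frac{k}{2}}(X_G)=k\,\overline{\eta}_1(\partial_2(G))\,\overline{\eta}_1\overline{\eta}_2^{2k-1}-(-1)^{|G|}\left(\partial_2(G)\,\overline{\eta}_2^{2k+1}-\overline{\eta}_1(\theta_2\partial_2(G))\,\overline{\eta}_1^{2k+1}\right)\qquad(k\in\mathbb{N}\setminus\{0\}).$$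
   Context: $C^\infty(\mathbb{R}^{1|2})$ is the superalgebra of functions $F=f_0(x)+f_1(x)\theta_1+f_2(x)\theta_2+f_{12}(x)\theta_1\theta_2$, with $f_0,f_1,f_2,f_{12}\in C^\infty(\mathbb{R})$, $x$ even, $\theta_1,\theta_2$ odd, $\theta_i\theta_j=-\theta_j\theta_i$; $|F|$ is the parity of a homogeneous $F$. Put $\partial_x=\partial/\partial x$, $F'=\partial_x F$, $\partial_i=\partial/\partial\theta_i$ (left derivatives), $\overline{\eta}_i=\partial_i-\theta_i\partial_x$ (so $\overline{\eta}_i^2=-\partial_x$), and $\alpha_2=dx+\theta_1d\theta_1+\theta_2d\theta_2$. For $F\in C^\infty(\mathbb{R}^{1|2})$ the contact vector field is $X_F=F\partial_x-\frac12(-1)^{|F|}\sum_{i=1}^2\overline{\eta}_i(F)\overline{\eta}_i$, with $[X_F,X_G]=X_{\{F,G\}}$, $\{F,G\}=FG'-F'G-\frac12(-1)^{|F|}\sum_{i=1}^2\overline{\eta}_i(F)\overline{\eta}_i(G)$. Here $$\mathfrak{osp}(2|2)=\mathrm{Span}(X_1,X_x,X_{x^2},X_{x\theta_1},X_{x\theta_2},X_{\theta_1},X_{\theta_2},X_{\theta_1\theta_2}),\qquad \mathfrak{osp}(1|2)=\mathrm{Span}(X_1,X_x,X_{x^2},X_{x\theta_1},X_{\theta_1}).$$ For $\lambda\in\mathbb{R}$, $\mathfrak{F}^2_\lambda=\{F\alpha_2^\lambda\mid F\in C^\infty(\mathbb{R}^{1|2})\}$, with action $\mathfrak{L}_{X_F}(G\alpha_2^\lambda)=\mathfrak{L}^\lambda_{X_F}(G)\alpha_2^\lambda$,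 $\mathfrak{L}^\lambda_{X_F}(G)=X_F(G)+\lambda F'G$. $\mathfrak{D}^2_{\lambda,\mu}$ is the superspace of linear differential operators $\mathfrak{F}^2_\lambda\to\mathfrak{F}^2_\mu$, i.e. operators $A(F\alpha_2^\lambda)=\sum_{\ell,m}a_{\ell,m}(x,\theta)\overline{\eta}_1^\ell\overline{\eta}_2^m(F)\alpha_2^\mu$ (finite sum), with action $X_F\cdot A=\mathfrak{L}^\mu_{X_F}\circ A-(-1)^{|A||F|}A\circ\mathfrak{L}^\lambda_{X_F}$. Relative cohomology: for a Lie superalgebra $\mathfrak{g}$, a subalgebra $\mathfrak{k}$ and a $\mathfrak{g}$-module $V$, $C^n(\mathfrak{g},\mathfrak{k};V)=\mathrm{Hom}_{\mathfrak{k}}(\Lambda^n(\mathfrak{g}/\mathfrak{k});V)$. In particular $C^0=V^{\mathfrak{k}}=\{v\in V\mid h\cdot v=0\ \forall h\in\mathfrak{k}\}$, and $C^1$ consists of the linear maps $\Upsilon:\mathfrak{g}\to V$ vanishing on $\mathfrak{k}$ with $\Upsilon([h,g])=(-1)^{|h||\Upsilon|}h\cdot\Upsilon(g)$ for $h\in\mathfrak{k}$, $g\in\mathfrak{g}$. The coboundary is $\delta v(g)=(-1)^{|g||v|}g\cdot v$ on $C^0$ and $\delta\Upsilon(g,h)=(-1)^{|g||\Upsilon|}g\cdot\Upsilon(h)-(-1)^{|h|(|g|+|\Upsilon|)}h\cdot\Upsilon(g)-\Upsilon([g,h])$ on $C^1$ (homogeneous elements, extended linearly). $\mathrm{H}^1(\mathfrak{g},\mathfrak{k};V)$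 is the space of relative 1-cocycles ($\delta\Upsilon=0$) modulo relative 1-coboundaries ($\delta v$, $v\in V^{\mathfrak{k}}$). $\mathrm{H}^1_{\mathrm{diff}}$ means that only cochains given by differential operators are considered. Formulas for $\Upsilon(X_G)$ are for homogeneous $G$ (extended linearly); they denote the operator $P$ in $\Upsilon(X_G)(F\alpha_2^\lambda)=P(F)\alpha_2^\mu$: functions written as results of applying an operator to $G$ act by left multiplication, and the remaining $\overline{\eta}_i$'s act on $F$. $\mathbb{N}$ includes $0$. *)

(* Defs.v *)
From HB Require Import structures.
From mathcomp Require Import all_boot all_order all_algebra.
From mathcomp Require Import all_classical all_reals all_analysis.
From mathcomp Require Import ring.
Import Order.TTheory GRing.Theory Num.Theory.
Import numFieldNormedType.Exports.

Set Implicit Arguments.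
Unset Strict Implicit.
Unset Printing Implicit Defensive.

Local Open Scope ring_scope.
Local Open Scope classical_set_scope.

Definition smooth (R : realType) : {pred R -> R} :=
  [pred f | `[< forall n x, derivable (derive1n n f) x 1 >]].

Section SmoothClosed.
Context (R : realType).
Implicit Types f g : R -> R.

Fixpoint Ck n f : Prop :=
  if n is m.+1 then (forall x, derivable f x 1) /\ Ck m (derive1 f) else True.

Lemma smoothP f : reflect (forall n, Ck n f) (f \in @smooth R).
Proof.
apply: (iffP (asboolP _)) => [fs n|fC n].
  elim: n f fs => //= n IHn f fs; split; first exact: (fs 0%N).
  by apply: IHn => m x; rewrite -derive1Sn; apply: fs.
elim: n f fC => [|n IHn] f fC x; first by case: (fC 1%N).
by rewrite derive1Sn; apply: IHn => m; case: (fC m.+1).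
Qed.

Lemma Ck_le n f : Ck n.+1 f -> Ck n f.
Proof.
by elim: n f => //= n IHn f [fd fC]; split=> //; apply: IHn.
Qed.

Lemma CkD n f g : Ck n f -> Ck n g -> Ck n (f + g).
Proof.
elim: n f g => //= n IHn f g [fd fC] [gd gC]; split=> [x|].
  exact: derivableD.
rewrite (_ : derive1 (f + g) = derive1 f + derive1 g); first exact: IHn.
by apply/funext => x; rewrite derive1E (deriveD (fd x) (gd x)) -!derive1E.
Qed.

Lemma CkM n f g : Ck n f -> Ck n g -> Ck n (f * g).
Proof.
elim: n f g => //= n IHn f g [fd fC] [gd gC]; split=> [x|].
  exact: derivableM.
rewrite (_ : derive1 (f * g) = f * derive1 g + g * derive1 f).
  apply: CkD; apply: IHn => //.
  - exact: (@Ck_le n f (conj fd fC)).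
  - exact: (@Ck_le n g (conj gd gC)).
by apply/funext => x; rewrite derive1E (deriveM (fd x) (gd x)) -!derive1E.
Qed.

Lemma Ck_cst n (c : R) : Ck n (cst c).
Proof.
elim: n c => //= n IHn c; split=> [x|]; first exact: derivable_cst.
rewrite (_ : derive1 (cst c) = cst 0); first exact: IHn.
by apply/funext => x; rewrite derive1_cst.
Qed.

Lemma CkZ n (c : R) f : Ck n f -> Ck n (c *: f).
Proof. exact: (CkM (Ck_cst n c)). Qed.

Lemma smooth_id : (@idfun R) \in @smooth R.
Proof.
apply/smoothP; case=> //= n; split=> [x|]; first exact: derivable_id.
rewrite (_ : derive1 idfun = cst 1); first exact: Ck_cst.
by apply/funext => x; exact: derive1_id.
Qed.

Lemma smooth_derive f : f \in @smooth R -> derive1 f \in @smooth R.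
Proof.
by move=> /smoothP fs; apply/smoothP => n; case: (fs n.+1).
Qed.

Lemma smooth_subring : subring_closed (@smooth R).
Proof.
split=> [|f g /smoothP fs /smoothP gs|f g /smoothP fs /smoothP gs].
- by apply/smoothP => n; exact: Ck_cst.
- apply/smoothP => n; apply: CkD => //.
  by rewrite -scaleN1r; apply: CkZ.
- by apply/smoothP => n; apply: CkM.
Qed.

Lemma smooth_submod : submod_closed (@smooth R).
Proof.
split=> [|a f g /smoothP fs /smoothP gs].
  by apply/smoothP => n; exact: Ck_cst.
by apply/smoothP => n; apply: CkD => //; apply: CkZ.
Qed.

End SmoothClosed.

HB.instance Definition _ (R : realType) :=
  GRing.isSubringClosed.Build (R -> R) (@smooth R) (@smooth_subring R).
HB.instance Definition _ (R : realType) :=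
  GRing.isSubmodClosed.Build R (R -> R) (@smooth R) (@smooth_submod R).

Record Cinf (R : realType) :=
  MkCinf { cfun :> R -> R; cfunP : cfun \in @smooth R }.

Section CinfTheory.
Context (R : realType).
Implicit Types (a b : R) (f g : Cinf R).

HB.instance Definition _ := [isSub for @cfun R].
HB.instance Definition _ := [Choice of Cinf R by <:].
HB.instance Definition _ := [SubChoice_isSubZmodule of Cinf R by <:].
HB.instance Definition _ := [SubZmodule_isSubNzRing of Cinf R by <:].
HB.instance Definition _ := [SubNzRing_isSubComNzRing of Cinf R by <:].
HB.instance Definition _ := [SubZmodule_isSubLmodule of Cinf R by <:].

Lemma Cinf_scalerAl (a : R) (f g : Cinf R) : a *: (f * g) = a *: f * g.
Proof.
by apply/val_inj/funext => x; rewrite /= !fctE /=; exact: mulrA.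
Qed.
HB.instance Definition _ :=
  GRing.Lmodule_isLalgebra.Build R (Cinf R) Cinf_scalerAl.
HB.instance Definition _ := GRing.Lalgebra_isComAlgebra.Build R (Cinf R).

Definition cX : Cinf R := MkCinf (smooth_id R).
Definition cD (f : Cinf R) : Cinf R := MkCinf (smooth_derive (cfunP f)).

Lemma cD_is_linear : linear cD.
Proof.
move=> a f g; apply/val_inj/funext => x /=.
have fd : derivable f x 1 by have /asboolP/(_ 0%N x) := cfunP f.
have gd : derivable g x 1 by have /asboolP/(_ 0%N x) := cfunP g.
rewrite derive1E (deriveD (derivableZ (k:=a) fd) gd) (deriveZ a fd) -!derive1E.
by [].
Qed.
HB.instance Definition _ :=
  GRing.isLinear.Build R (Cinf R) (Cinf R) _ cD cD_is_linear.

Lemma cDM (f g : Cinf R) : cD (f * g) = cD f * g + f * cD g.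
Proof.
apply/val_inj/funext => x /=.
have fd : derivable f x 1 by have /asboolP/(_ 0%N x) := cfunP f.
have gd : derivable g x 1 by have /asboolP/(_ 0%N x) := cfunP g.
rewrite derive1E (deriveM fd gd) -!derive1E addrC; congr (_ + _).
exact: mulrC.
Qed.

Lemma cD1 : cD 1 = 0.
Proof. by apply/val_inj/funext => x; exact: derive1_cst. Qed.

Lemma cD_cX : cD cX = 1.
Proof. by apply/val_inj/funext => x; exact: derive1_id. Qed.

Lemma cD0 : cD 0 = 0. Proof. exact: raddf0. Qed.
Lemma cDN f : cD (- f) = - cD f. Proof. exact: raddfN. Qed.
Lemma cDD f g : cD (f + g) = cD f + cD g. Proof. exact: raddfD. Qed.

Definition const (a : R) : Cinf R := a%:A.

Lemma scale_const a f : a *: f = const a * f.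
Proof. by rewrite mulr_algl. Qed.
Lemma constD a b : const (a + b) = const a + const b.
Proof. exact: scalerDl. Qed.
Lemma constN a : const (- a) = - const a.
Proof. exact: scaleNr. Qed.
Lemma constM a b : const (a * b) = const a * const b.
Proof. by rewrite mulr_algl scalerA. Qed.
Lemma const0 : const 0 = 0. Proof. exact: scale0r. Qed.
Lemma const1 : const 1 = 1. Proof. exact: scale1r. Qed.
Lemma const2 : const 2^-1 * 2 = 1.
Proof.
have -> : 2 = const 2 by rewrite [LHS]mulr2n -const1 -constD.
by rewrite -constM mulVf ?const1 // pnatr_eq0.
Qed.
Lemma cD_const a : cD (const a) = 0.
Proof. by rewrite linearZ /= cD1 scaler0. Qed.

Lemma quad (Q : Cinf R -> Cinf R) (h : Cinf R) : h * 2 = 1 ->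
  Q h = (1 - h * 2) * ((1 + 2 * h) * Q 0 - h * (3 * Q 0 + Q 1)) -> Q h = 0.
Proof. by move=> -> ->; rewrite subrr mul0r. Qed.

End CinfTheory.

Arguments cD : simpl never.
Arguments cX : simpl never.

(* Proves identities of degree at most 2 in the constant 1/2. *)
Ltac Cinf_ring :=
  apply/subr0_eq;
  repeat match goal with |- context [cD ?f] => move: (cD f) => ? end;
  try match goal with |- context [@const ?R (GRing.inv ?t)] =>
    let h := fresh "h" in let hh := fresh "hh" in
    move: (@const R (GRing.inv t)) (@const2 R) => h hh;
    match goal with |- ?E = _ =>
      match (eval pattern h in E) with ?q h => apply: (@quad _ q h hh) end end;
    cbv beta; clear hh
  end; ring.

(* SuperFun f0 f1 f2 f12 is f0 + f1 theta_1 + f2 theta_2 + f12 theta_1 theta_2 *)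
Record superfun (R : realType) :=
  SuperFun { s0 : Cinf R; s1 : Cinf R; s2 : Cinf R; s12 : Cinf R }.
Arguments SuperFun {R}.

Section SuperFunctions.
Context (R : realType).
Implicit Types F G H : superfun R.

Let tosum F := (s0 F, s1 F, s2 F, s12 F).
Let ofsum (p : Cinf R * Cinf R * Cinf R * Cinf R) :=
  SuperFun p.1.1.1 p.1.1.2 p.1.2 p.2.
Lemma superfunK : cancel tosum ofsum. Proof. by case. Qed.
HB.instance Definition _ := Choice.copy (superfun R) (can_type superfunK).

Lemma superfunP F G :
  s0 F = s0 G -> s1 F = s1 G -> s2 F = s2 G -> s12 F = s12 G -> F = G.
Proof. by case: F => ????; case: G => ???? /= -> -> -> ->. Qed.

Definition sadd F G :=
  SuperFun (s0 F + s0 G) (s1 F + s1 G) (s2 F + s2 G) (s12 F + s12 G).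
Definition sopp F := SuperFun (- s0 F) (- s1 F) (- s2 F) (- s12 F).
Definition sscale (a : R) F :=
  SuperFun (a *: s0 F) (a *: s1 F) (a *: s2 F) (a *: s12 F).
Definition smul F G :=
  SuperFun (s0 F * s0 G)
       (s0 F * s1 G + s1 F * s0 G)
       (s0 F * s2 G + s2 F * s0 G)
       (s0 F * s12 G + s1 F * s2 G - s2 F * s1 G + s12 F * s0 G).

Let saddA : associative sadd.
Proof. by move=> F G H; apply: superfunP; rewrite /= addrA. Qed.
Let saddC : commutative sadd.
Proof. by move=> F G; apply: superfunP; rewrite /= addrC. Qed.
Let sadd0 : left_id (SuperFun 0 0 0 0) sadd.
Proof. by move=> F; apply: superfunP; rewrite /= add0r. Qed.
Let saddN : left_inverse (SuperFun 0 0 0 0) sopp sadd.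
Proof. by move=> F; apply: superfunP; rewrite /= addNr. Qed.
HB.instance Definition _ :=
  GRing.isZmodule.Build (superfun R) saddA saddC sadd0 saddN.

Let sscaleA a b F : sscale a (sscale b F) = sscale (a * b) F.
Proof. by apply: superfunP; rewrite /= scalerA. Qed.
Let sscale1 : left_id 1 sscale.
Proof. by move=> F; apply: superfunP; rewrite /= scale1r. Qed.
Let sscaleDr : right_distributive sscale +%R.
Proof. by move=> a F G; apply: superfunP; rewrite /= scalerDr. Qed.
Let sscaleDl F : {morph sscale^~ F : a b / a + b}.
Proof. by move=> a b; apply: superfunP; rewrite /= scalerDl. Qed.
HB.instance Definition _ :=
  GRing.Zmodule_isLmodule.Build R (superfun R) sscaleA sscale1 sscaleDr sscaleDl.

Let smulA : associative smul.
Proof. by move=> F G H; apply: superfunP => /=; ring. Qed.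
Let smul1l : left_id (SuperFun 1 0 0 0) smul.
Proof. by move=> F; apply: superfunP => /=; ring. Qed.
Let smul1r : right_id (SuperFun 1 0 0 0) smul.
Proof. by move=> F; apply: superfunP => /=; ring. Qed.
Let smulDl : left_distributive smul +%R.
Proof. by move=> F G H; apply: superfunP => /=; ring. Qed.
Let smulDr : right_distributive smul +%R.
Proof. by move=> F G H; apply: superfunP => /=; ring. Qed.
Let sone_neq0 : SuperFun 1 0 0 0 != 0.
Proof. by apply/eqP => /(congr1 (@s0 R)) /eqP; rewrite oner_eq0. Qed.
HB.instance Definition _ := GRing.Zmodule_isNzRing.Build (superfun R)
  smulA smul1l smul1r smulDl smulDr sone_neq0.

Let sscaleAl (a : R) F G : a *: (F * G) = a *: F * G.
Proof.
have [k kE] : {k : Cinf R | forall f, a *: f = k * f}.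
  by exists a%:A => f; rewrite mulr_algl.
by apply: superfunP => /=; rewrite !kE; ring.
Qed.
HB.instance Definition _ := GRing.Lmodule_isLalgebra.Build R (superfun R) sscaleAl.
Let sscaleAr (a : R) F G : a *: (F * G) = F * (a *: G).
Proof.
have [k kE] : {k : Cinf R | forall f, a *: f = k * f}.
  by exists a%:A => f; rewrite mulr_algl.
by apply: superfunP => /=; rewrite !kE; ring.
Qed.
HB.instance Definition _ := GRing.Lalgebra_isAlgebra.Build R (superfun R) sscaleAr.

Definition sx : superfun R := SuperFun (cX R) 0 0 0.
Definition th1 : superfun R := SuperFun 0 1 0 0.
Definition th2 : superfun R := SuperFun 0 0 1 0.

(* parity component; [true] is odd *)
Definition spart (p : bool) F :=
  if p then SuperFun 0 (s1 F) (s2 F) 0 else SuperFun (s0 F) 0 0 (s12 F).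

(* (-1)^(q|F|) F, extended linearly *)
Definition stwist (q : bool) F := spart false F + (-1) ^+ q *: spart true F.

Definition dx F := SuperFun (cD (s0 F)) (cD (s1 F)) (cD (s2 F)) (cD (s12 F)).
Definition d1 F := SuperFun (s1 F) 0 (s12 F) 0.
Definition d2 F := SuperFun (s2 F) (- s12 F) 0 0.
Definition eta1 F := d1 F - th1 * dx F.
Definition eta2 F := d2 F - th2 * dx F.

(* (-1)^|F| eta_i(F), extended linearly, is eta_i (stwist true F). *)
Definition contact F : superfun R -> superfun R := fun H =>
  F * dx H - 2^-1 *: (eta1 (stwist true F) * eta1 H
                      + eta2 (stwist true F) * eta2 H).

Definition cbracket F G :=
  F * dx G - dx F * G - 2^-1 *: (eta1 (stwist true F) * eta1 G
                                 + eta2 (stwist true F) * eta2 G).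

Lemma s0D F G : s0 (F + G) = s0 F + s0 G. Proof. by []. Qed.
Lemma s0N F : s0 (- F) = - s0 F. Proof. by []. Qed.
Lemma s0Z a F : s0 (a *: F) = a *: s0 F. Proof. by []. Qed.
Lemma s0M F G : s0 (F * G) = s0 F * s0 G.
Proof. by []. Qed.
Lemma s0_0 : s0 (0 : superfun R) = 0. Proof. by []. Qed.
Lemma s0_1 : s0 (1 : superfun R) = 1. Proof. by []. Qed.
Definition s0E := (s0D, s0N, s0Z, s0M, s0_0, s0_1).
Lemma s1D F G : s1 (F + G) = s1 F + s1 G. Proof. by []. Qed.
Lemma s1N F : s1 (- F) = - s1 F. Proof. by []. Qed.
Lemma s1Z a F : s1 (a *: F) = a *: s1 F. Proof. by []. Qed.
Lemma s1M F G : s1 (F * G) = s0 F * s1 G + s1 F * s0 G.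
Proof. by []. Qed.
Lemma s1_0 : s1 (0 : superfun R) = 0. Proof. by []. Qed.
Lemma s1_1 : s1 (1 : superfun R) = 0. Proof. by []. Qed.
Definition s1E := (s1D, s1N, s1Z, s1M, s1_0, s1_1).
Lemma s2D F G : s2 (F + G) = s2 F + s2 G. Proof. by []. Qed.
Lemma s2N F : s2 (- F) = - s2 F. Proof. by []. Qed.
Lemma s2Z a F : s2 (a *: F) = a *: s2 F. Proof. by []. Qed.
Lemma s2M F G : s2 (F * G) = s0 F * s2 G + s2 F * s0 G.
Proof. by []. Qed.
Lemma s2_0 : s2 (0 : superfun R) = 0. Proof. by []. Qed.
Lemma s2_1 : s2 (1 : superfun R) = 0. Proof. by []. Qed.
Definition s2E := (s2D, s2N, s2Z, s2M, s2_0, s2_1).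
Lemma s12D F G : s12 (F + G) = s12 F + s12 G. Proof. by []. Qed.
Lemma s12N F : s12 (- F) = - s12 F. Proof. by []. Qed.
Lemma s12Z a F : s12 (a *: F) = a *: s12 F. Proof. by []. Qed.
Lemma s12M F G : s12 (F * G) = s0 F * s12 G + s1 F * s2 G - s2 F * s1 G + s12 F * s0 G.
Proof. by []. Qed.
Lemma s12_0 : s12 (0 : superfun R) = 0. Proof. by []. Qed.
Lemma s12_1 : s12 (1 : superfun R) = 0. Proof. by []. Qed.
Definition s12E := (s12D, s12N, s12Z, s12M, s12_0, s12_1).
Definition superfunE := (s0E, s1E, s2E, s12E).

Lemma stwistE F : stwist true F = SuperFun (s0 F) (- s1 F) (- s2 F) (s12 F).
Proof.
by apply: superfunP;
  rewrite ?superfunE /= expr1 scaleN1r ?oppr0 ?addr0 ?add0r.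
Qed.

Lemma eta1E F :
  eta1 F = SuperFun (s1 F) (- cD (s0 F)) (s12 F) (- cD (s2 F)).
Proof. by apply: superfunP; rewrite ?superfunE /=; ring. Qed.

Lemma eta2E F :
  eta2 F = SuperFun (s2 F) (- s12 F) (- cD (s0 F)) (cD (s1 F)).
Proof. by apply: superfunP; rewrite ?superfunE /=; ring. Qed.

Lemma contactE F H : contact F H =
  SuperFun (s0 F * cD (s0 H) + const 2^-1 * (s1 F * s1 H + s2 F * s2 H))
   (s0 F * cD (s1 H) + const 2^-1 * (cD (s0 F) * s1 H + s12 F * s2 H
                               + s1 F * cD (s0 H) - s2 F * s12 H))
   (s0 F * cD (s2 H) + const 2^-1 * (cD (s0 F) * s2 H - s12 F * s1 H
                               + s2 F * cD (s0 H) + s1 F * s12 H))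
   (s0 F * cD (s12 H) + cD (s0 F) * s12 H
    + const 2^-1 * (s1 F * cD (s2 H) - s2 F * cD (s1 H)
              + cD (s1 F) * s2 H - cD (s2 F) * s1 H)).
Proof.
rewrite /contact stwistE !eta1E !eta2E /=.
by apply: superfunP; rewrite !superfunE /= scale_const ?cDN; Cinf_ring.
Qed.

Lemma contact_even (a d : Cinf R) H : contact (SuperFun a 0 0 d) H =
  SuperFun (a * cD (s0 H))
           (a * cD (s1 H) + const 2^-1 * (cD a * s1 H + d * s2 H))
           (a * cD (s2 H) + const 2^-1 * (cD a * s2 H - d * s1 H))
           (a * cD (s12 H) + cD a * s12 H).
Proof. by rewrite contactE /= cD0; apply: superfunP => /=; Cinf_ring. Qed.

Lemma contact_odd (b c : Cinf R) H : contact (SuperFun 0 b c 0) H =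
  SuperFun (const 2^-1 * (b * s1 H + c * s2 H))
           (const 2^-1 * (b * cD (s0 H) - c * s12 H))
           (const 2^-1 * (c * cD (s0 H) + b * s12 H))
           (const 2^-1 * (b * cD (s2 H) - c * cD (s1 H) + cD b * s2 H - cD c * s1 H)).
Proof. by rewrite contactE /= cD0; apply: superfunP => /=; Cinf_ring. Qed.

Lemma cbracketE F G : cbracket F G = contact F G - dx F * G.
Proof. by rewrite /cbracket /contact addrAC. Qed.

Lemma cbracket_ee (a d a' d' : Cinf R) :
  cbracket (SuperFun a 0 0 d) (SuperFun a' 0 0 d')
  = SuperFun (a * cD a' - cD a * a') 0 0 (a * cD d' - cD d * a').
Proof.
rewrite cbracketE contact_even /dx; apply: superfunP; rewrite ?superfunE /= ?cD0;
Cinf_ring.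
Qed.
Lemma cbracket_eo (a d b c : Cinf R) :
  cbracket (SuperFun a 0 0 d) (SuperFun 0 b c 0)
  = SuperFun 0 (a * cD b - const 2^-1 * (cD a * b - d * c))
               (a * cD c - const 2^-1 * (cD a * c + d * b)) 0.
Proof.
rewrite cbracketE contact_even /dx; apply: superfunP; rewrite ?superfunE /= ?cD0;
Cinf_ring.
Qed.
Lemma cbracket_oe (a d b c : Cinf R) :
  cbracket (SuperFun 0 b c 0) (SuperFun a 0 0 d)
  = SuperFun 0 (const 2^-1 * (b * cD a - c * d) - cD b * a)
               (const 2^-1 * (c * cD a + b * d) - cD c * a) 0.
Proof.
rewrite cbracketE contact_odd /dx; apply: superfunP; rewrite ?superfunE /= ?cD0;
Cinf_ring.
Qed.
Lemma cbracket_oo (b c b' c' : Cinf R) :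
  cbracket (SuperFun 0 b c 0) (SuperFun 0 b' c' 0)
  = SuperFun (const 2^-1 * (b * b' + c * c')) 0 0
     (const 2^-1 * (b * cD c' - c * cD b' - cD b * c' + cD c * b')).
Proof.
rewrite cbracketE contact_odd /dx; apply: superfunP; rewrite ?superfunE /= ?cD0;
Cinf_ring.
Qed.

Lemma superfunDP F G H : s0 F + s0 G = s0 H -> s1 F + s1 G = s1 H ->
  s2 F + s2 G = s2 H -> s12 F + s12 G = s12 H -> F + G = H.
Proof. by move=> *; apply: superfunP. Qed.
Lemma superfunBP F G H : s0 F - s0 G = s0 H -> s1 F - s1 G = s1 H ->
  s2 F - s2 G = s2 H -> s12 F - s12 G = s12 H -> F - G = H.
Proof. by move=> *; apply: superfunP. Qed.

Ltac bracket_solve :=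
  rewrite ?contact_even ?contact_odd;
  first [apply: superfunDP | apply: superfunBP]; rewrite /=;
  rewrite ?(cDD, cDN, cDM, cD_const); Cinf_ring.

(* [contact_inj] and [contact_bracket] identify the Lie superalgebra of contact
   vector fields with the superfunctions under [cbracket]. *)
Lemma contact_inj : injective contact.
Proof.
move=> F G FG; have halfI (f g : Cinf R) : const 2^-1 * f = const 2^-1 * g -> f = g.
  by move=> /(congr1 ( *%R 2)); rewrite !mulrA [2 * _]mulrC const2 !mul1r.
have E H : [/\ s0 (contact H sx) = s0 H, s1 (contact H sx) = const 2^-1 * s1 H,
    s2 (contact H sx) = const 2^-1 * s2 H & s2 (contact H th1) = - (const 2^-1 * s12 H)].
  split; rewrite contactE /= ?cD0 ?cD_cX ?cD1
    ?(mulr0, mulr1, add0r, addr0, subr0, sub0r, oppr0, mulrN) //.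
have [F0 F1 F2 F3] := E F; have [G0 G1 G2 G3] := E G.
apply: superfunP; first by rewrite -F0 FG G0.
- by apply: halfI; rewrite -F1 FG G1.
- by apply: halfI; rewrite -F2 FG G2.
- by apply/halfI/oppr_inj; rewrite -F3 FG G3.
Qed.

Lemma contact_bracket (p q : bool) F G H : spart p F = F -> spart q G = G ->
  contact F (contact G H) - (-1) ^+ (p && q) *: contact G (contact F H)
  = contact (cbracket F G) H.
Proof.
case: p; case: q => <- <-;
  rewrite /spart ?expr0 ?expr1 ?scale1r ?scaleN1r ?opprK.
by rewrite cbracket_oo; bracket_solve.
by rewrite cbracket_oe; bracket_solve.
by rewrite cbracket_eo; bracket_solve.
by rewrite cbracket_ee; bracket_solve.
Qed.

End SuperFunctions.

Section DiffOps.
Context (R : realType).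
Implicit Types (F G H : superfun R) (lam mu : R).

Definition Lie lam F G := contact F G + lam *: (dx F * G).

(* Operators F_lam -> F_mu, written on the coefficients of alpha_2^lam and
   alpha_2^mu; the underlying superspace does not depend on (lam, mu). *)
Definition operator := superfun R -> superfun R.
HB.instance Definition _ := GRing.Lmodule.on operator.
Implicit Types A : operator.

Definition is_diffop A := exists N (a : nat -> nat -> superfun R), forall H,
  A H = \sum_(l < N) \sum_(m < N)
          a l m * iter l (@eta1 R) (iter m (@eta2 R) H).

Definition opart (p : bool) A : operator :=
  fun H => \sum_(q : bool) spart (p (+) q) (A (spart q H)).

Definition diffop (p : bool) : set operator :=
  [set A | is_diffop A /\ opart p A = A].

(* (-1)^(|A||F|) A o L_F is the sum over q of A_q o L_((-1)^(q|F|) F) *)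
Definition opact lam mu F A : operator := fun H =>
  Lie mu F (A H) - \sum_(q : bool) opart q A (Lie lam (stwist q F) H).

End DiffOps.

Definition span_of (R : realType) (V : lmodType R) (s : seq V) : set V :=
  [set v | exists c : 'I_(size s) -> R, v = \sum_(i < size s) c i *: s`_i].

Section Osp.
Context (R : realType).
Local Notation x := (@sx R).
Local Notation t1 := (@th1 R).
Local Notation t2 := (@th2 R).
Implicit Types F G : superfun R.

Definition osp22_gen : seq (superfun R) :=
  [:: 1; x; x ^+ 2; x * t1; x * t2; t1; t2; t1 * t2].
Definition osp12_gen : seq (superfun R) := [:: 1; x; x ^+ 2; x * t1; t1].

Definition osp22_pred : {pred superfun R} :=
  [pred F | `[< span_of osp22_gen F >]].

Lemma osp22P F : reflect
  (exists a b c d e f g h : R, F = SuperFun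
     (const a + const b * cX R + const c * (cX R * cX R))
     (const d + const e * cX R) (const f + const g * cX R) (const h))
  (F \in osp22_pred).
Proof.
have E (s : nat -> R) : \sum_(i < 8) s i *: osp22_gen`_i = SuperFun
     (const (s 0) + const (s 1) * cX R + const (s 2) * (cX R * cX R))
     (const (s 5) + const (s 3) * cX R)
     (const (s 6) + const (s 4) * cX R) (const (s 7)).
  rewrite !big_ord_recr big_ord0 /= expr2.
  by apply: superfunP; rewrite !superfunE /= !scale_const; ring.
apply: (iffP (asboolP _)) => [[c ->]|[a [b [c [d [e [f [g [h ->]]]]]]]]].
  pose s n := c (inord n).
  exists (s 0), (s 1), (s 2), (s 5), (s 3), (s 6), (s 4), (s 7).
  by rewrite -E; apply: eq_bigr => i _; rewrite /s inord_val.
pose s := nth 0 [:: a; b; c; e; g; d; f; h].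
by exists (fun i => s i); rewrite (E s).
Qed.

Lemma osp22_submod : submod_closed osp22_pred.
Proof.
split=> [|k F G].
  apply/osp22P; do 8 exists 0; apply: superfunP;
    by rewrite /= !const0 ?mul0r ?addr0.
move=> /osp22P[a [b [c [d [e [f [g [h ->]]]]]]]].
move=> /osp22P[a' [b' [c' [d' [e' [f' [g' [h' ->]]]]]]]].
apply/osp22P; exists (k * a + a'), (k * b + b'), (k * c + c'), (k * d + d'),
  (k * e + e'), (k * f + f'), (k * g + g'), (k * h + h').
by apply: superfunP; rewrite superfunE /= scale_const !(constD, constM); ring.
Qed.

Lemma osp22_cbracket F G :
  F \in osp22_pred -> G \in osp22_pred -> cbracket F G \in osp22_pred.
Proof.
move=> /osp22P[a [b [c [d [e [f [g [h ->]]]]]]]].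
move=> /osp22P[a' [b' [c' [d' [e' [f' [g' [h' ->]]]]]]]].
apply/osp22P; rewrite cbracketE contactE /dx /=.
exists (a * b' - b * a' + 2^-1 * (d * d' + f * f')).
exists ((1 + 1) * (a * c' - c * a') + 2^-1 * (d * e' + e * d' + f * g' + g * f')).
exists (b * c' - c * b' + 2^-1 * (e * e' + g * g')).
exists (a * e' - e * a' + 2^-1 * (h * f' + d * b' - f * h' - b * d')).
exists (d * c' - c * d' + 2^-1 * (b * e' - e * b' + h * g' - g * h')).
exists (a * g' - g * a' + 2^-1 * (f * b' - b * f' - h * d' + d * h')).
exists (f * c' - c * f' + 2^-1 * (b * g' - g * b' - h * e' + e * h')).
exists (2^-1 * (d * g' - f * e' - e * f' + g * d')).
apply: superfunBP; rewrite /= !(constD, constN, constM, const1) !(cDD, cDM, cD_const, cD_cX);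
  Cinf_ring.
Qed.

End Osp.

HB.instance Definition _ (R : realType) :=
  GRing.isSubmodClosed.Build R (superfun R) (@osp22_pred R) (@osp22_submod R).

(* The contact vector field X_F in osp(2|2) is represented by F. *)
Record osp22 (R : realType) :=
  Osp22 { gen :> superfun R; genP : gen \in @osp22_pred R }.

Section Osp22.
Context (R : realType).

HB.instance Definition _ := [isSub for @gen R].
HB.instance Definition _ := [Choice of osp22 R by <:].
HB.instance Definition _ := [SubChoice_isSubZmodule of osp22 R by <:].
HB.instance Definition _ := [SubZmodule_isSubLmodule of osp22 R by <:].

Definition osp22_br (F G : osp22 R) : osp22 R :=
  Osp22 (osp22_cbracket (genP F) (genP G)).

Definition osp22_par (p : bool) : set (osp22 R) :=
  [set F | spart p (gen F) = gen F].

Definition osp12 : set (osp22 R) := [set F | span_of (osp12_gen R) (gen F)].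

End Osp22.

Section RelativeCohomology.
(* [gpar p] and [Vpar p] are the subspaces of elements of parity [p]; the module
   is [Vpar false + Vpar true] inside [V]. *)
Context {R : realType} {g V : lmodType R}.
Context (gpar : bool -> set g) (br : g -> g -> g) (k : set g).
Context (Vpar : bool -> set V) (act : g -> V -> V).
(* [adm] restricts the 1-cochains, here to differential operators *)
Context (adm : set (g -> V)).
Implicit Types (p q r : bool) (U : g -> V) (v : V).

Definition cochain0 p v := Vpar p v /\ forall h, k h -> act h v = 0.

Definition cochain1 p U :=
  [/\ linear U, adm U, (forall q y, gpar q y -> Vpar (p (+) q) (U y)),
      (forall h, k h -> U h = 0) &
      (forall q h y, k h -> gpar q h ->
         U (br h y) = (-1) ^+ (q && p) *: act h (U y))].

Definition is_delta0 p v U :=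
  linear U /\ forall q y, gpar q y -> U y = (-1) ^+ (q && p) *: act y v.

Definition delta1_eq0 p U := forall q r y z, gpar q y -> gpar r z ->
  (-1) ^+ (q && p) *: act y (U z)
  - (-1) ^+ (r && (q (+) p)) *: act z (U y) - U (br y z) = 0.

Definition cocycles1 : set (g -> V) :=
  [set U | exists U_ : bool -> g -> V,
     (forall p, cochain1 p (U_ p) /\ delta1_eq0 p (U_ p))
     /\ U = \sum_(p : bool) U_ p].

Definition coboundaries1 : set (g -> V) :=
  [set U | exists (v_ : bool -> V) (U_ : bool -> g -> V),
     (forall p, cochain0 p (v_ p) /\ is_delta0 p (v_ p) (U_ p))
     /\ U = \sum_(p : bool) U_ p].

End RelativeCohomology.

(* The classes of c_0, ..., c_(n-1) form a basis of Z / B, for subspaces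
   B of Z of V. *)
Definition quotient_basis (R : realType) (V : lmodType R) (Z B : set V)
    (n : nat) (c : 'I_n -> V) :=
  [/\ (forall i, Z (c i)),
      (forall a : 'I_n -> R, B (\sum_(i < n) a i *: c i) -> forall i, a i = 0) &
      (forall z, Z z -> exists a : 'I_n -> R, B (z - \sum_(i < n) a i *: c i))].

Definition quotient_dim (R : realType) (V : lmodType R) (Z B : set V) (n : nat) :=
  exists c : 'I_n -> V, quotient_basis Z B c.

Definition class_generates (R : realType) (V : lmodType R) (Z B : set V) (c : V) :=
  Z c /\ forall z, Z z -> exists a : R, B (z - a *: c).

Section Main.
Context (R : realType).
Implicit Types (lam mu : R) (U : osp22 R -> operator R).

Definition diff_cochain : set (osp22 R -> operator R) :=
  [set U | exists N (a : nat -> nat -> nat -> nat -> superfun R), forall G H,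
     U G H = \sum_(i < N) \sum_(j < N) \sum_(l < N) \sum_(m < N)
       a i j l m * iter i (@eta1 R) (iter j (@eta2 R) (gen G))
                 * iter l (@eta1 R) (iter m (@eta2 R) H)].

Definition Z1 lam mu := cocycles1 (@osp22_par R) (@osp22_br R) (@osp12 R)
  (@diffop R) (fun G => opact lam mu (gen G)) diff_cochain.

Definition B1 lam mu := coboundaries1 (@osp22_par R) (@osp12 R)
  (@diffop R) (fun G => opact lam mu (gen G)).

Definition dimH1 lam mu (n : nat) := quotient_dim (Z1 lam mu) (B1 lam mu) n.

(* In these formulas [(-1)^|G| P(G)] is [P (stwist true G)]. *)
Definition Ups_diag lam : osp22 R -> operator R := fun G H =>
  let sG := stwist true (gen G) in
  (2 * lam) *: (eta1 (d2 (gen G)) * H)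
  - (d2 sG * eta1 H + th2 R * eta2 (eta1 sG) * eta2 H).

Definition Ups_half (k : nat) : osp22 R -> operator R := fun G H =>
  let sG := stwist true (gen G) in
  k%:R *: (eta1 (d2 (gen G)) * eta1 (iter (2 * k - 1)%N (@eta2 R) H))
  - (d2 sG * iter (2 * k + 1)%N (@eta2 R) H
     - eta1 (th2 R * d2 sG) * iter (2 * k + 1)%N (@eta1 R) H).

End Main.

(* Main.v *)
From HB Require Import structures.
Require Import Defs.
From mathcomp Require Import all_boot all_order all_algebra.
From mathcomp Require Import all_classical all_reals all_analysis.
From mathcomp Require Import ring lra.
Import Order.TTheory GRing.Theory Num.Theory.
Import numFieldNormedType.Exports.

Set Implicit Arguments.
Unset Strict Implicit.
Unset Printing Implicit Defensive.

Local Open Scope ring_scope.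

(** Write g = osp(2|2), k = osp(1|2), D = d/dx and eta_i for the operator
    d_i - theta_i D. The k-module g/k has the basis theta_2, x theta_2,
    theta_1 theta_2 and is generated by its lowest weight vector theta_2, so a
    relative 1-cochain U is determined by the operator B = U(2 theta_2)
    ([rel_cochain_eq0]). Equivariance makes B invariant under D and under the
    odd translation attached to theta_1, and fixes its weight. The cocycle
    identity at (theta_2, theta_2), where {theta_2, theta_2} lies in k, adds the
    invariance under the other odd translation. Hence B has constant
    coefficients: with n = mu - lam it is c D^n eta_1 + d D^n eta_2 for even U,
    and with n = mu - lam + 1/2 it is c D^n + d D^(n-1) eta_2 eta_1 for odd U
    ([lowest_weight_even], [lowest_weight_odd]).

    One more relation restricts lam: {x^2, {x^2, theta_2}} = 0, so the square of
    the action of x^2 kills B. Evaluated on a well chosen monomial it becomes a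
    quadratic equation in lam ([lowest_weight_sl2]). For odd U it leaves D^n with
    n <= 1, and D^(n-1) eta_2 eta_1 with 2 lam = - n or 2 lam = 1 - n; for even U
    it leaves n = 0, or n >= 1 and lam = - n/2.

    The 0-cochains are the k-invariant operators. As a k-module, the densities
    on the superline of dimension 1|2 are two copies of densities on the
    superline of dimension 1|1, so the identity and the odd powers of eta_1
    supply such operators for the same values of lam and mu. Their coboundaries
    produce every admissible B except two: eta_1 when lam = mu <> 0, and
    D^k eta_2 when lam = - k/2, mu = k/2, k > 0. These are, up to a factor, the
    lowest weight vectors of the two stated families, whose cocycle identities
    are polynomial identities between the components ([Ups_diag_cocycle],
    [Ups_half_cocycle]). So the cohomology vanishes outside the two families and
    is generated by one class inside them ([odd_cocycle_coboundary],
    [diag_cocycle], [half_cocycle], [generic_cocycle]). *)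

(** * Iterated derivatives of smooth functions *)

Section IteratedDerivative.
Context (R : realType).
Implicit Types (f g : Cinf R) (a : R) (n : nat).
Local Notation X := (cX R).

Definition cDn n f := iter n (@cD R) f.

Lemma cDn_is_linear n : linear (cDn n).
Proof.
by move=> a f g; elim: n => //= n IHn; rewrite /cDn /= -/(cDn n _) IHn linearP.
Qed.
HB.instance Definition _ n :=
  GRing.isLinear.Build R (Cinf R) (Cinf R) _ (cDn n) (cDn_is_linear n).

Lemma cDn_const n a f : cDn n (const a * f) = const a * cDn n f.
Proof. by rewrite -!scale_const linearZ. Qed.

Lemma cDn_cD n f : cDn n (cD f) = cD (cDn n f).
Proof. by rewrite /cDn -iterSr. Qed.

Lemma cDnS n f : cDn n.+1 f = cD (cDn n f).
Proof. by []. Qed.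

Lemma cD_constM a f : cD (const a * f) = const a * cD f.
Proof. exact: (@cDn_const 1). Qed.

Lemma cD_XM f : cD (X * f) = f + X * cD f.
Proof. by rewrite cDM cD_cX mul1r. Qed.

(** The commutators [D^n, x] and [[D^n, x], x]. Naming them lets identities
    that hold uniformly in n be checked by ring arithmetic, with no truncated
    exponent n - 1 or n - 2 in sight. *)
Definition cDn' n f := const n%:R * cDn n.-1 f.
Definition cDn'' n f := const (n%:R * (n%:R - 1)) * cDn n.-2 f.

Lemma cDn_XM n f : cDn n (X * f) = X * cDn n f + cDn' n f.
Proof.
rewrite /cDn'; elim: n => [|n IHn]; first by rewrite const0 mul0r addr0.
rewrite cDnS IHn cDD cD_XM cD_constM -natr1 constD const1 /=.
by case: n {IHn} => [|n] /=; rewrite ?const0 -?cDnS /=; ring.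
Qed.

Lemma cDn'_cD n f : cDn' n (cD f) = const n%:R * cDn n f.
Proof. by rewrite /cDn' cDn_cD; case: n => //=; rewrite const0 !mul0r. Qed.

Lemma cD_cDn' n f : cD (cDn' n f) = const n%:R * cDn n f.
Proof. by rewrite -cDn'_cD /cDn' cDn_cD cD_constM. Qed.

Lemma cDn''_cD n f : cDn'' n (cD f) = const (n%:R - 1) * cDn' n f.
Proof.
rewrite constD constN const1 /cDn'' /cDn' cDn_cD; case: n => [|[|n]] /=.
- by rewrite const0 !mul0r const0 mul0r mulr0.
- by rewrite subrr mulr0 const1 const0 subrr !mul0r.
- by rewrite -!cDnS -natr1 addrK !(constM, constD, const1); ring.
Qed.

Lemma cD_cDn'' n f : cD (cDn'' n f) = const (n%:R - 1) * cDn' n f.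
Proof. by rewrite -cDn''_cD /cDn'' cDn_cD cD_constM. Qed.

Lemma cDn'_XM n f : cDn' n (X * f) = X * cDn' n f + cDn'' n f.
Proof.
rewrite /cDn' /cDn''; case: n => [|n] /=.
  by rewrite mul0r const0 !mul0r mulr0 addr0.
rewrite cDn_XM /cDn' -natr1 addrK !(constD, constM) const1; ring.
Qed.

Lemma cDn'_const n a f : cDn' n (const a * f) = const a * cDn' n f.
Proof. by rewrite /cDn' cDn_const mulrCA. Qed.

Lemma cDn'D n f g : cDn' n (f + g) = cDn' n f + cDn' n g.
Proof. by rewrite /cDn' linearD mulrDr. Qed.

Lemma cDn'N n f : cDn' n (- f) = - cDn' n f.
Proof. by rewrite /cDn' linearN mulrN. Qed.

Lemma cDnMn n f m : cDn n (f *+ m) = cDn n f *+ m. Proof. exact: linearMn. Qed.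
Lemma cDnD n f g : cDn n (f + g) = cDn n f + cDn n g. Proof. exact: linearD. Qed.
Lemma cDnN n f : cDn n (- f) = - cDn n f. Proof. exact: linearN. Qed.
Lemma cDn_0 n : cDn n 0 = 0. Proof. exact: linear0. Qed.
Lemma cDMn f m : cD (f *+ m) = cD f *+ m. Proof. exact: linearMn. Qed.

End IteratedDerivative.

Definition cDnE := (cDnD, cDnN, cDnMn, cDn_0, cDn_const, cDn_XM, cDn_cD).
Definition cDn'E := (cDn'D, cDn'N, cDn'_const, cDn'_XM, cDn'_cD, cD_cDn',
  cDn''_cD, cD_cDn'').
Definition cDE := (cD0, cD1, cDD, cDN, cDMn, cD_constM, cD_XM, cD_cX, cD_const).

(** Generalizing the derivatives, constants and components first leaves [ring] an
    identity between variables. *)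
Ltac gring :=
  repeat match goal with
  | |- context [cD ?f] => move: (cD f) => ?
  | |- context [cDn'' ?n ?f] => move: (cDn'' n f) => ?
  | |- context [cDn' ?n ?f] => move: (cDn' n f) => ?
  | |- context [cDn ?n ?f] => move: (cDn n f) => ?
  | |- context [const ?a] => move: (const a) => ?
  | |- context [cX ?R] => move: (cX R) => ?
  | |- context [s0 ?f] => move: (s0 f) => ?
  | |- context [s1 ?f] => move: (s1 f) => ?
  | |- context [s2 ?f] => move: (s2 f) => ?
  | |- context [s12 ?f] => move: (s12 f) => ?
  end; ring.

(** * Homogeneous elements of osp(2|2) and homogeneous operators *)

Section Homogeneous.
Context (R : realType).
Implicit Types (f g : Cinf R) (a b c d lam mu : R) (p q r : bool).
Implicit Types (F G H : superfun R) (A : operator R).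
Local Notation X := (cX R).

(** The coordinates are doubled so that the factors 1/2 of the contact fields
    disappear from [Lie_even] and [Lie_odd]. *)
Definition osp_even a b c d : superfun R :=
  SuperFun (const a + (const b * X) *+ 2 + const c * (X * X)) 0 0
           (const d *+ 2).
Definition osp_odd a b c d : superfun R :=
  SuperFun 0 ((const a + const b * X) *+ 2) ((const c + const d * X) *+ 2) 0.

Lemma const_half f : const (2^-1 : R) * (f *+ 2) = f.
Proof. by rewrite -[f in LHS]mul1r -mulrnAl mulrA const2 mul1r. Qed.

Lemma constMn a n : const (a *+ n) = const a *+ n.
Proof. by rewrite /const scalerMnl. Qed.

Lemma halfMn a : (a / 2) *+ 2 = a.
Proof. by rewrite -mulr_natr mulfVK // pnatr_eq0. Qed.

Lemma osp22_evenP F : F \in @osp22_pred R -> spart false F = F ->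
  exists a b c d, F = osp_even a b c d.
Proof.
move=> /osp22P[a [b [c [d [e [f [g [h FE]]]]]]]] <-; rewrite FE.
exists a, (b / 2), c, (h / 2); apply: superfunP => //=.
  by rewrite -mulrnAl -constMn halfMn.
by rewrite -constMn halfMn.
Qed.

Lemma osp22_oddP F : F \in @osp22_pred R -> spart true F = F ->
  exists a b c d, F = osp_odd a b c d.
Proof.
move=> /osp22P[a [b [c [d [e [f [g [h FE]]]]]]]] <-; rewrite FE.
exists (d / 2), (e / 2), (f / 2), (g / 2); apply: superfunP => //=;
  by rewrite mulrnDl -mulrnAl -!constMn !halfMn.
Qed.

Lemma osp_even_in a b c d : osp_even a b c d \in @osp22_pred R.
Proof.
apply/osp22P; exists a, (b *+ 2), c, 0, 0, 0, 0, (d *+ 2).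
by apply: superfunP; rewrite /= ?constMn ?const0 ?mulrnAl ?mul0r ?addr0.
Qed.

Lemma osp_odd_in a b c d : osp_odd a b c d \in @osp22_pred R.
Proof.
apply/osp22P; exists 0, 0, 0, (a *+ 2), (b *+ 2), (c *+ 2), (d *+ 2), 0.
by apply: superfunP;
  rewrite /= ?constMn ?const0 ?mulrnAl ?mul0r ?addr0 ?mulrnDl ?mulrnAl.
Qed.

Lemma osp12P (F : osp22 R) : osp12 F -> exists a b c d e, gen F =
  SuperFun (const a + const b * X + const c * (X * X)) (const d + const e * X)
    0 0.
Proof.
case=> s ->; pose t n := s (inord n); exists (t 0), (t 1), (t 2), (t 4), (t 3).
rewrite (eq_bigr (fun i : 'I_5 => t i *: (osp12_gen R)`_i)); last first.
  by move=> i _; rewrite /t inord_val.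
rewrite !big_ord_recr big_ord0 /= expr2.
by apply: superfunP; rewrite !superfunE /= ?scale_const; gring.
Qed.

Lemma osp12_in_even (F : osp22 R) a b c :
  gen F = osp_even a b c 0 -> osp12 F.
Proof.
move=> E; exists (fun i : 'I_5 => nth 0 [:: a; b *+ 2; c; 0; 0] i).
rewrite E !big_ord_recr big_ord0 /= expr2.
apply: superfunP; rewrite !superfunE /= ?scale_const ?constMn ?const0; gring.
Qed.

Lemma osp12_in_odd (F : osp22 R) a b :
  gen F = osp_odd a b 0 0 -> osp12 F.
Proof.
move=> E; exists (fun i : 'I_5 => nth 0 [:: 0; 0; 0; b *+ 2; a *+ 2] i).
rewrite E !big_ord_recr big_ord0 /= expr2.
apply: superfunP; rewrite !superfunE /= ?scale_const ?constMn ?const0; gring.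
Qed.

Lemma LieE lam F H : Lie lam F H = SuperFun
  (s0 F * cD (s0 H) + const 2^-1 * (s1 F * s1 H + s2 F * s2 H)
   + const lam * (cD (s0 F) * s0 H))
  (s0 F * cD (s1 H) + const 2^-1 * (cD (s0 F) * s1 H + s12 F * s2 H
     + s1 F * cD (s0 H) - s2 F * s12 H)
   + const lam * (cD (s0 F) * s1 H + cD (s1 F) * s0 H))
  (s0 F * cD (s2 H) + const 2^-1 * (cD (s0 F) * s2 H - s12 F * s1 H
     + s2 F * cD (s0 H) + s1 F * s12 H)
   + const lam * (cD (s0 F) * s2 H + cD (s2 F) * s0 H))
  (s0 F * cD (s12 H) + cD (s0 F) * s12 H
   + const 2^-1 * (s1 F * cD (s2 H) - s2 F * cD (s1 H)
     + cD (s1 F) * s2 H - cD (s2 F) * s1 H)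
   + const lam * (cD (s0 F) * s12 H + cD (s1 F) * s2 H - cD (s2 F) * s1 H
     + cD (s12 F) * s0 H)).
Proof. by rewrite /Lie contactE; apply: superfunP; rewrite /= scale_const. Qed.

(** A monomial times a derivative is written as nested products by a constant
    or by x, the shape that the Leibniz rules of [cDnE] rewrite. *)
Lemma Lie_even lam a b c d H : Lie lam (osp_even a b c d) H = SuperFun
  (const a * cD (s0 H) + (const b * (X * cD (s0 H))) *+ 2
   + const c * (X * (X * cD (s0 H)))
   + (const lam * (const b * s0 H)) *+ 2
   + (const lam * (const c * (X * s0 H))) *+ 2)
  (const a * cD (s1 H) + (const b * (X * cD (s1 H))) *+ 2
   + const c * (X * (X * cD (s1 H)))
   + (const lam * (const b * s1 H)) *+ 2
   + (const lam * (const c * (X * s1 H))) *+ 2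
   + const b * s1 H + const c * (X * s1 H) + const d * s2 H)
  (const a * cD (s2 H) + (const b * (X * cD (s2 H))) *+ 2
   + const c * (X * (X * cD (s2 H)))
   + (const lam * (const b * s2 H)) *+ 2
   + (const lam * (const c * (X * s2 H))) *+ 2
   + const b * s2 H + const c * (X * s2 H) - const d * s1 H)
  (const a * cD (s12 H) + (const b * (X * cD (s12 H))) *+ 2
   + const c * (X * (X * cD (s12 H)))
   + (const lam * (const b * s12 H)) *+ 2
   + (const lam * (const c * (X * s12 H))) *+ 2
   + (const b * s12 H) *+ 2 + (const c * (X * s12 H)) *+ 2).
Proof.
rewrite LieE /=.
by apply: superfunP; rewrite /= ?cDE; Cinf_ring.
Qed.

Lemma Lie_odd lam a b c d H : Lie lam (osp_odd a b c d) H = SuperFun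
  (const a * s1 H + const b * (X * s1 H) + const c * s2 H
   + const d * (X * s2 H))
  (const a * cD (s0 H) + const b * (X * cD (s0 H))
   + (const lam * (const b * s0 H)) *+ 2
   - const c * s12 H - const d * (X * s12 H))
  (const c * cD (s0 H) + const d * (X * cD (s0 H))
   + (const lam * (const d * s0 H)) *+ 2
   + const a * s12 H + const b * (X * s12 H))
  (const a * cD (s2 H) + const b * (X * cD (s2 H))
   - const c * cD (s1 H) - const d * (X * cD (s1 H))
   + const b * s2 H - const d * s1 H
   + (const lam * (const b * s2 H)) *+ 2
   - (const lam * (const d * s1 H)) *+ 2).
Proof.
rewrite LieE /=.
by apply: superfunP; rewrite /= ?cDE; Cinf_ring.
Qed.

End Homogeneous.

(** * The action on differential operators *)

Section Action.
Context (R : realType).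
Implicit Types (a b c d k lam mu : R) (p q r s t : bool).
Implicit Types (F G H : superfun R) (A : operator R).

Lemma spart_spart p q F : spart p (spart q F) = if p == q then spart q F else 0.
Proof. by case: p; case: q; apply: superfunP. Qed.

Lemma spart_is_linear p : linear (@spart R p).
Proof.
by move=> k F G; case: p; apply: superfunP; rewrite /= ?scaler0 ?addr0.
Qed.
HB.instance Definition _ p :=
  GRing.isLinear.Build R (superfun R) (superfun R) _ (@spart R p)
    (@spart_is_linear p).

Lemma spart_sum F : spart true F + spart false F = F.
Proof. by apply: superfunP; rewrite /= ?addr0 ?add0r. Qed.

Lemma stwist_is_linear q : linear (@stwist R q).
Proof.
move=> k F G; rewrite /stwist !linearP /= !scalerDr !scalerA [k * _]mulrC.
by rewrite addrACA.
Qed.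
HB.instance Definition _ q :=
  GRing.isLinear.Build R (superfun R) (superfun R) _ (@stwist R q)
    (@stwist_is_linear q).

Lemma stwist_hom q r F : spart r F = F -> stwist q F = (-1) ^+ (q && r) *: F.
Proof.
by case: q; case: r => <-; rewrite /stwist;
  apply: superfunP; rewrite /= ?(scaler0, addr0, add0r, scale1r).
Qed.

Lemma Lie_linearr lam F : linear (Lie lam F).
Proof.
move=> k H1 H2; rewrite !LieE; apply: superfunP; rewrite /= !linearP /=
  !scale_const; Cinf_ring.
Qed.
HB.instance Definition _ lam F :=
  GRing.isLinear.Build R (superfun R) (superfun R) _ (Lie lam F)
    (@Lie_linearr lam F).

Lemma Lie_linearl lam H : linear ((@Lie R lam)^~ H).
Proof.
move=> k F1 F2; rewrite !LieE; apply: superfunP; rewrite /= !linearP /=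
  !scale_const; Cinf_ring.
Qed.

Lemma Lie_hom lam r t F H : spart r F = F -> spart t H = H ->
  spart (r (+) t) (Lie lam F H) = Lie lam F H.
Proof.
by rewrite LieE; case: r; case: t => <- <-;
  apply: superfunP; rewrite /= ?cD0 //; Cinf_ring.
Qed.

Lemma Lie_cbracket lam r s F G H : spart r F = F -> spart s G = G ->
  Lie lam (cbracket F G) H
  = Lie lam F (Lie lam G H) - (-1) ^+ (r && s) *: Lie lam G (Lie lam F H).
Proof.
have Le (f g : Cinf R) K : Lie lam (SuperFun f 0 0 g) K = SuperFun
    (f * cD (s0 K) + const lam * (cD f * s0 K))
    (f * cD (s1 K) + const 2^-1 * (cD f * s1 K + g * s2 K)
     + const lam * (cD f * s1 K))
    (f * cD (s2 K) + const 2^-1 * (cD f * s2 K - g * s1 K)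
     + const lam * (cD f * s2 K))
    (f * cD (s12 K) + cD f * s12 K
     + const lam * (cD f * s12 K + cD g * s0 K)).
  by rewrite LieE /= cD0; apply: superfunP => /=; Cinf_ring.
have Lo (f g : Cinf R) K : Lie lam (SuperFun 0 f g 0) K = SuperFun
    (const 2^-1 * (f * s1 K + g * s2 K))
    (const 2^-1 * (f * cD (s0 K) - g * s12 K) + const lam * (cD f * s0 K))
    (const 2^-1 * (g * cD (s0 K) + f * s12 K) + const lam * (cD g * s0 K))
    (const 2^-1 * (f * cD (s2 K) - g * cD (s1 K) + cD f * s2 K - cD g * s1 K)
     + const lam * (cD f * s2 K - cD g * s1 K)).
  by rewrite LieE /= cD0; apply: superfunP => /=; Cinf_ring.
case: r; case: s => <- <-; rewrite /spart
  ?expr0 ?expr1 ?scale1r ?scaleN1r ?opprK.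
- rewrite cbracket_oo !(Lo, Le); apply: superfunP;
    rewrite /= ?(cDD, cDN, cDM, cD_const); Cinf_ring.
- rewrite cbracket_oe !(Lo, Le); apply: superfunP;
    rewrite /= ?(cDD, cDN, cDM, cD_const); Cinf_ring.
- rewrite cbracket_eo !(Lo, Le); apply: superfunP;
    rewrite /= ?(cDD, cDN, cDM, cD_const); Cinf_ring.
- rewrite cbracket_ee !Le; apply: superfunP;
    rewrite /= ?(cDD, cDN, cDM, cD_const); Cinf_ring.
Qed.

Arguments spart : simpl never.

Lemma linear_additive (V W : lmodType R) (f : V -> W) : linear f ->
  [/\ f 0 = 0, {morph f : x / - x}, {morph f : x y / x + y} &
      forall k, {morph f : x / k *: x}].
Proof.
move=> fl; have f0 : f 0 = 0.
  by apply: (addrI (f 0)); rewrite addr0 -{2}[f 0]scale1r addrC -fl scaler0 addr0.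
have fZ k : {morph f : x / k *: x}.
  by move=> x; rewrite -[k *: x]addr0 fl f0 addr0.
split=> // x; first by rewrite -scaleN1r fZ scaleN1r.
by move=> y; rewrite -[x]scale1r fl !scale1r.
Qed.

Lemma opart_linear q A : linear A -> linear (opart q A).
Proof.
move=> Al k F G; rewrite /opart scaler_sumr -big_split /=.
by apply: eq_bigr => s _; rewrite !linearP Al linearP.
Qed.

Lemma homop q t A H : linear A -> opart q A = A -> spart t H = H ->
  spart (q (+) t) (A H) = A H.
Proof.
move=> Al hA hH; have [A0 _ _ _] := linear_additive Al.
move: hH; case: t => hH; rewrite -hA /opart big_bool /= -hH !spart_spart /=
  A0 linear0 ?addr0 ?add0r spart_spart eqxx //.
Qed.

Lemma opart_hom q A : linear A ->
  (forall t H, spart t H = H -> spart (q (+) t) (A H) = A H) -> opart q A = A.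
Proof.
move=> Al hA; have [_ _ AD _] := linear_additive Al.
apply/funext => H; rewrite /opart big_bool /= !hA ?spart_spart //.
by rewrite -AD spart_sum.
Qed.

Lemma opart_other q A : linear A -> opart q A = A -> opart (~~ q) A = 0.
Proof.
move=> Al hA; apply/funext => H; rewrite /opart big_bool /=.
rewrite -(homop (t:=true) (H:=spart true H) Al hA) ?spart_spart //.
rewrite -(homop (t:=false) (H:=spart false H) Al hA) ?spart_spart //.
by case: q {hA} => /=; rewrite ?spart_spart /= addr0.
Qed.

(** On homogeneous arguments the sum over parities in [opact] has a single term
    and the action is the supercommutator. *)
Lemma opact_hom lam mu q r F A H : linear A -> opart q A = A ->
  spart r F = F -> opact lam mu F A H
  = Lie mu F (A H) - (-1) ^+ (q && r) *: A (Lie lam F H).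
Proof.
move=> Al hA hF; rewrite /opact; congr (_ - _); rewrite (bigD1 q) //= hA.
rewrite big1 ?addr0; last first.
  move=> s sq; have -> : s = ~~ q by case: (s) sq; case: (q).
  by rewrite opart_other.
have [_ _ _ AZ] := linear_additive Al.
rewrite (stwist_hom _ hF); have [_ _ _ LZ] := linear_additive (Lie_linearl lam H).
by rewrite LZ AZ.
Qed.

Lemma opact_linear lam mu F A : linear A -> linear (opact lam mu F A).
Proof.
move=> Al k H1 H2; rewrite /opact Al linearP /= scalerBr addrACA; congr (_ + _).
rewrite -opprD; congr (- _); rewrite scaler_sumr -big_split /=.
by apply: eq_bigr => s _; rewrite linearP opart_linear.
Qed.

Lemma opact_linearl lam mu A : linear A -> linear ((opact lam mu)^~ A).
Proof.
move=> Al k F G; apply/funext => H; rewrite /opact Lie_linearl.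
rewrite -[RHS]/(k *: _ + _) scalerBr addrACA; congr (_ + _).
rewrite -opprD; congr (- _); rewrite scaler_sumr -big_split /=.
by apply: eq_bigr => s _; rewrite linearP Lie_linearl opart_linear.
Qed.

Lemma opact_par lam mu q r F A : linear A -> opart q A = A -> spart r F = F ->
  opart (q (+) r) (opact lam mu F A) = opact lam mu F A.
Proof.
move=> Al hA hF; apply: opart_hom; first exact: opact_linear.
move=> t H hH; rewrite (opact_hom _ _ _ Al hA hF) linearB linearZ /=.
rewrite -addbA [r (+) t]addbC addbA [q (+) t (+) r]addbC.
rewrite (Lie_hom _ hF (homop Al hA hH)); congr (_ - _ *: _).
by rewrite [r (+) _]addbC -addbA [t (+) r]addbC homop // Lie_hom.
Qed.

(** Operators between density modules form a module over the contact
    superalgebra, since the density modules do. *)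
Lemma opact_cbracket lam mu p q r F G A : linear A -> opart p A = A ->
  spart q F = F -> spart r G = G ->
  opact lam mu (cbracket F G) A = opact lam mu F (opact lam mu G A)
    - (-1) ^+ (q && r) *: opact lam mu G (opact lam mu F A).
Proof.
move=> Al hA hF hG; apply/funext => H.
have hFG : spart (q (+) r) (cbracket F G) = cbracket F G.
  by rewrite cbracketE contactE; move: hF hG; case: q; case: r => <- <-;
    apply: superfunP; rewrite /= ?cD0 //; Cinf_ring.
rewrite (opact_hom _ _ _ Al hA hFG) -[RHS]/(_ - (-1) ^+ (q && r) *: _).
have GAl := opact_linear lam mu G Al; have FAl := opact_linear lam mu F Al.
rewrite (opact_hom _ _ _ GAl (opact_par _ _ Al hA hG) hF).
rewrite (opact_hom _ _ _ FAl (opact_par _ _ Al hA hF) hG).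
rewrite !(opact_hom _ _ _ Al hA hF) !(opact_hom _ _ _ Al hA hG).
rewrite !(Lie_cbracket _ _ hF hG).
move: (linear_additive (Lie_linearr mu F)) (linear_additive (Lie_linearr mu G)).
move: (Lie mu F) (Lie mu G) (Lie lam F) (Lie lam G) => f g f' g'.
move=> [_ fN fD fZ] [_ gN gD gZ]; have [_ AN AD AZ] := linear_additive Al.
rewrite !(AD, AN, AZ, fN, fD, fZ, gN, gD, gZ).
case: p q r {hA hF hG hFG} => [] [] [] /=;
  rewrite ?expr0 ?expr1 ?scale1r ?scaleN1r ?opprK ?scalerN ?opprB ?opprD ?opprK;
  repeat match goal with
  | |- context [f ?h] => move: (f h) => ?
  | |- context [g ?h] => move: (g h) => ?
  | |- context [A ?h] => move: (A h) => ?
  end; apply: superfunP; rewrite /=; ring.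
Qed.

End Action.

(** * Differential operators on the line of a given weight *)

Section ScalarOperators.
Context (R : realType).
Implicit Types (f h : Cinf R) (T : Cinf R -> Cinf R) (b : nat -> Cinf R).
Implicit Types (c w : R) (N n m : nat).
Local Notation X := (cX R).

(** The vanishing tail of the coefficients allows the order to be raised, as sums
    of operators of different orders require. *)
Definition scalar_diffop T := exists N b, (forall n, (N <= n)%N -> b n = 0) /\
  forall h, T h = \sum_(n < N) b n * cDn n h.

Lemma sum_widen N M b h : (forall n, (N <= n)%N -> b n = 0) -> (N <= M)%N ->
  \sum_(n < N) b n * cDn n h = \sum_(n < M) b n * cDn n h.
Proof.
move=> b0 NM; rewrite (big_ord_widen M (fun n => b n * cDn n h) NM) big_mkcond.
apply: eq_bigr => n _; case: ltnP => // Nn; by rewrite b0 ?mul0r.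
Qed.

Lemma scalar_diffop_ext T T' : T =1 T' -> scalar_diffop T -> scalar_diffop T'.
Proof. by move=> E [N [b [b0 bE]]]; exists N, b; split=> // h; rewrite -E. Qed.

Lemma scalar_diffop0 : scalar_diffop (fun=> 0).
Proof. by exists 0%N, (fun=> 0); split=> // h; rewrite big_ord0. Qed.

Lemma scalar_diffop_id : scalar_diffop id.
Proof.
exists 1%N, (fun n => (n == 0%N)%:R); split=> [[]//|h].
by rewrite big_ord1 mul1r.
Qed.

Lemma scalar_diffopD T T' : scalar_diffop T -> scalar_diffop T' ->
  scalar_diffop (fun h => T h + T' h).
Proof.
move=> [N [b [b0 bE]]] [M [d [d0 dE]]]; exists (maxn N M), (fun n => b n + d n).
split=> [n|h]; first by rewrite geq_max => /andP[/b0 -> /d0 ->]; rewrite addr0.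
rewrite bE dE (sum_widen _ b0 (leq_maxl N M)) (sum_widen _ d0 (leq_maxr N M)).
by rewrite -big_split; apply: eq_bigr => n _; rewrite mulrDl.
Qed.

Lemma scalar_diffopM f T : scalar_diffop T -> scalar_diffop (fun h => f * T h).
Proof.
move=> [N [b [b0 bE]]]; exists N, (fun n => f * b n).
split=> [n /b0 ->|h]; first by rewrite mulr0.
by rewrite bE mulr_sumr; apply: eq_bigr => n _; rewrite mulrA.
Qed.

Lemma scalar_diffopN T : scalar_diffop T -> scalar_diffop (fun h => - T h).
Proof.
move=> /(scalar_diffopM (-1)); apply: scalar_diffop_ext => h; exact: mulN1r.
Qed.

Lemma scalar_diffop_cD T : scalar_diffop T -> scalar_diffop (fun h => cD (T h)).
Proof.
move=> [N [b [b0 bE]]].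
exists N.+1, (fun n => cD (b n) + (if n is m.+1 then b m else 0)).
split=> [[//|n] Nn|h]; first by rewrite !b0 ?cD0 ?addr0 // ltnW.
rewrite bE linear_sum /=; under eq_bigr do rewrite cDM.
rewrite big_split /=; under [RHS]eq_bigr do rewrite mulrDl.
rewrite [RHS]big_split; congr (_ + _) => /=.
  by rewrite big_ord_recr /= b0 // cD0 mul0r addr0.
by rewrite big_ord_recl /= mul0r add0r.
Qed.

Lemma cD_Xn n : cD (X ^+ n.+1) = const n.+1%:R * X ^+ n.
Proof.
elim: n => [|n IHn]; first by rewrite expr1 cD_cX const1 mulr1.
rewrite exprS cDM cD_cX IHn -[n.+2%:R]natr1 constD const1 exprS; ring.
Qed.

Lemma cDn_Xn n : cDn n (X ^+ n) = const n`!%:R.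
Proof.
elim: n => [|n IHn]; first by rewrite /cDn /= const1.
by rewrite cDnS -cDn_cD cD_Xn cDn_const IHn -constM -natrM factS.
Qed.

Lemma cDn_Xn0 n m : (n < m)%N -> cDn m (X ^+ n) = 0.
Proof.
move=> /subnK <-; rewrite addnC.
elim: (m - n.+1)%N => [|k IHk]; first by rewrite addn0 cDnS cDn_Xn cD_const.
by rewrite addnS cDnS IHk cD0.
Qed.

Lemma const_inj0 c f : c != 0 -> const c * f = 0 -> f = 0.
Proof.
move=> c0 /(congr1 (fun g => const c^-1 * g)).
by rewrite mulr0 mulrA -constM mulVf // const1 mul1r.
Qed.

(** Evaluate on x^n: the coefficients below n vanish by induction, and the
    derivatives of order above n kill x^n. *)
Lemma scalar_diffop_inj N b :
  (forall h, \sum_(n < N) b n * cDn n h = 0) -> forall n, (n < N)%N -> b n = 0.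
Proof.
move=> b0; elim/ltn_ind => n IHn nN.
have := b0 (X ^+ n); rewrite (bigD1 (Ordinal nN)) //= big1 ?addr0.
  rewrite cDn_Xn mulrC; apply: const_inj0.
  by rewrite pnatr_eq0 -lt0n fact_gt0.
move=> [m mN] /=; rewrite -val_eqE /= neq_ltn => /orP[mn|nm].
  by rewrite IHn ?mul0r.
by rewrite cDn_Xn0 ?mulr0.
Qed.

Lemma cD_eq0 f : cD f = 0 -> exists c, f = const c.
Proof.
move=> f0; exists (f 0); apply/val_inj/funext => x /=.
rewrite !fctE /= -[RHS]/(f 0 * 1) mulr1; apply: is_derive_0_is_cst => y.
have fd : derivable f y 1 by have /asboolP/(_ 0%N y) := cfunP f.
apply: DeriveDef => //; rewrite -derive1E.
exact: (congr1 (fun g : Cinf R => g y) f0).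
Qed.

(** Invariance under translations makes the coefficients constant. The bracket
    with the Euler field x D multiplies the coefficient of D^n by n, so a weight
    w allows only n = w. *)
Lemma scalar_diffop_weight w T : scalar_diffop T ->
  (forall h, T (cD h) = cD (T h)) ->
  (forall h, T (X * cD h) = X * cD (T h) + const w * T h) ->
  exists n c, (c != 0 -> w = n%:R) /\ forall h, T h = const c * cDn n h.
Proof.
move=> [N [b [b0 bE]]] TD TX.
have {}b0' n : (n < N)%N -> cD (b n) = 0.
  move: n; apply: scalar_diffop_inj => h.
  have := TD h; rewrite !bE linear_sum /=; under [RHS]eq_bigr do rewrite cDM.
  rewrite big_split /=; under eq_bigr do rewrite cDn_cD.
  by move=> /esym/eqP; rewrite -subr_eq0 addrK => /eqP.
have bw n : (n < N)%N -> const (n%:R - w) * b n = 0.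
  move: n; apply: (@scalar_diffop_inj _ (fun n => const (n%:R - w) * b n)) => h.
  have := TX h; rewrite !bE linear_sum /= !mulr_sumr -big_split /=.
  move=> /eqP; rewrite -subr_eq0 -sumrB => /eqP; apply: etrans.
  apply: eq_bigr => n _; rewrite cDn_XM cDn'_cD cDn_cD cDM b0' //.
  by rewrite constD constN; ring.
have [[n nN bn]|none] := pselect (exists2 n, (n < N)%N & b n != 0); last first.
  exists 0%N, 0; split=> [|h]; first by rewrite eqxx.
  rewrite const0 mul0r bE big1 // => n _.
  suff -> : b n = 0 by rewrite mul0r.
  by apply/eqP/negPn/negP => bn; apply: none; exists n.
have wn : w = n%:R.
  apply/eqP; rewrite eq_sym -subr_eq0; apply/negPn/negP => nw.
  by move/eqP: bn; apply; apply: const_inj0 nw _; exact: bw.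
have [c bc] := cD_eq0 (b0' n nN); exists n, c; split=> // h.
rewrite bE (bigD1 (Ordinal nN)) //= big1 ?addr0 ?bc // => -[m mN].
rewrite -val_eqE /= => mn; suff -> : b m = 0 by rewrite mul0r.
by apply: (@const_inj0 (m%:R - w)); [rewrite wn subr_eq0 eqr_nat|exact: bw].
Qed.

End ScalarOperators.

(** * Closure properties of differential operators *)

Section DifferentialOperators.
Context (R : realType).
Implicit Types (F G H : superfun R) (A B : operator R).

Lemma eta1_is_linear : linear (@eta1 R).
Proof.
move=> k F G; rewrite !eta1E; apply: superfunP;
  by rewrite /= ?linearP /= ?opprD ?scalerN.
Qed.
HB.instance Definition _ :=
  GRing.isLinear.Build R (superfun R) (superfun R) _ (@eta1 R) eta1_is_linear.

Lemma eta2_is_linear : linear (@eta2 R).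
Proof.
move=> k F G; rewrite !eta2E; apply: superfunP;
  by rewrite /= ?linearP /= ?opprD ?scalerN.
Qed.
HB.instance Definition _ :=
  GRing.isLinear.Build R (superfun R) (superfun R) _ (@eta2 R) eta2_is_linear.

Lemma eta1M F G : eta1 (F * G) = eta1 F * G + stwist true F * eta1 G.
Proof.
rewrite stwistE !eta1E; apply: superfunP;
  rewrite /= ?(cDD, cDN, cDM); ring.
Qed.

Lemma eta2M F G : eta2 (F * G) = eta2 F * G + stwist true F * eta2 G.
Proof.
rewrite stwistE !eta2E; apply: superfunP;
  rewrite /= ?(cDD, cDN, cDM); ring.
Qed.

Lemma eta21 H : eta2 (eta1 H) = - eta1 (eta2 H).
Proof. by rewrite !(eta1E, eta2E); apply: superfunP; rewrite /= ?cDN ?opprK. Qed.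

Lemma eta2_iter_eta1 l H :
  eta2 (iter l (@eta1 R) H) = (-1) ^+ l *: iter l (@eta1 R) (eta2 H).
Proof.
elim: l => [|l IHl]; first by rewrite expr0 scale1r.
by rewrite /= eta21 IHl linearZ exprS mulN1r scaleNr.
Qed.

Lemma iter_linear (V : lmodType R) (f : V -> V) n : linear f -> linear (iter n f).
Proof. by move=> fl k x y; elim: n => //= n ->; rewrite fl. Qed.

Lemma diffop_linear A : is_diffop A -> linear A.
Proof.
move=> [N [a E]] k F G; rewrite !E scaler_sumr -big_split; apply: eq_bigr => l _.
rewrite scaler_sumr -big_split; apply: eq_bigr => m _ /=.
rewrite (iter_linear _ eta2_is_linear) (iter_linear _ eta1_is_linear).
by rewrite mulrDr scalerAr.
Qed.

Lemma diffop_ext A B : A =1 B -> is_diffop A -> is_diffop B.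
Proof. by move=> E [N [a Aa]]; exists N, a => H; rewrite -E. Qed.

Lemma diffop_mono a l m :
  is_diffop (fun H => a * iter l (@eta1 R) (iter m (@eta2 R) H)).
Proof.
exists (maxn l m).+1, (fun l' m' => if (l' == l) && (m' == m) then a else 0) => H.
have lN : (l < (maxn l m).+1)%N by rewrite ltnS leq_maxl.
have mN : (m < (maxn l m).+1)%N by rewrite ltnS leq_maxr.
rewrite (bigD1 (Ordinal lN)) //= (bigD1 (Ordinal mN)) //= !eqxx /=.
rewrite big1 ?addr0 => [|i im]; last first.
  by rewrite (negPf im : (i == m :> nat) = false) mul0r.
rewrite big1 ?addr0 // => i il; apply: big1 => j _.
by rewrite (negPf il : (i == l :> nat) = false) mul0r.
Qed.

Lemma diffopD A B : is_diffop A -> is_diffop B -> is_diffop (fun H => A H + B H).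
Proof.
move=> [N [a Aa]] [M [b Bb]].
pose t K (c : nat -> nat -> superfun R) l m :=
  if (l < K)%N && (m < K)%N then c l m else 0.
have tE K (c : nat -> nat -> superfun R) L H : (K <= L)%N ->
    \sum_(l < K) \sum_(m < K) c l m * iter l (@eta1 R) (iter m (@eta2 R) H)
  = \sum_(l < L) \sum_(m < L) t K c l m * iter l (@eta1 R) (iter m (@eta2 R) H).
  move=> KL; pose e l m := c l m * iter l (@eta1 R) (iter m (@eta2 R) H).
  rewrite (big_ord_widen L (fun l => \sum_(m < K) e l m) KL) big_mkcond.
  apply: eq_bigr => l _; case: ifP => lK; last first.
    by rewrite big1 // => m _; rewrite /t lK mul0r.
  rewrite (big_ord_widen L (e l) KL) big_mkcond; apply: eq_bigr => m _.
  by rewrite /t lK /e; case: ifP; rewrite ?mul0r.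
exists (maxn N M), (fun l m => t N a l m + t M b l m) => H.
rewrite Aa Bb (tE _ _ _ _ (leq_maxl N M)) (tE _ _ _ _ (leq_maxr N M)).
rewrite -big_split; apply: eq_bigr => l _; rewrite -big_split.
by apply: eq_bigr => m _; rewrite mulrDl.
Qed.

Lemma diffop0 : is_diffop (fun=> 0 : superfun R).
Proof. by exists 0%N, (fun _ _ => 0) => H; rewrite big_ord0. Qed.

Lemma diffop_sum N (A : nat -> operator R) : (forall i, is_diffop (A i)) ->
  is_diffop (fun H => \sum_(i < N) A i H).
Proof.
move=> hA; elim: N => [|N IHN].
  by apply: diffop_ext diffop0 => H; rewrite big_ord0.
by apply: diffop_ext (diffopD IHN (hA N)) => H; rewrite big_ord_recr.
Qed.

Lemma diffopM F A : is_diffop A -> is_diffop (fun H => F * A H).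
Proof.
move=> [N [a Aa]]; exists N, (fun l m => F * a l m) => H; rewrite Aa mulr_sumr.
apply: eq_bigr => l _; rewrite mulr_sumr; apply: eq_bigr => m _.
by rewrite mulrA.
Qed.

Lemma diffopZ (k : R) A : is_diffop A -> is_diffop (fun H => k *: A H).
Proof.
by move=> /(diffopM k%:A); apply: diffop_ext => H; rewrite mulr_algl.
Qed.

Lemma diffopN A : is_diffop A -> is_diffop (fun H => - A H).
Proof. by move=> /(diffopM (-1)); apply: diffop_ext => H; rewrite mulN1r. Qed.

Lemma diffop_id : is_diffop (id : operator R).
Proof. by apply: diffop_ext (diffop_mono 1 0 0) => H; rewrite mul1r. Qed.

Lemma diffop_eta1 A : is_diffop A -> is_diffop (fun H => eta1 (A H)).
Proof.
move=> [N [a Aa]].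
pose T l m : operator R := fun H =>
  eta1 (a l m) * iter l (@eta1 R) (iter m (@eta2 R) H)
  + stwist true (a l m) * iter l.+1 (@eta1 R) (iter m (@eta2 R) H).
apply: (@diffop_ext (fun H => \sum_(l < N) \sum_(m < N) T l m H)).
  move=> H; rewrite Aa linear_sum; apply: eq_bigr => l _; rewrite linear_sum.
  by apply: eq_bigr => m _; rewrite /= eta1M.
apply: (diffop_sum N (A := fun l H => \sum_(m < N) T l m H)) => l.
by apply: (diffop_sum N (A := T l)) => m; apply: diffopD; apply: diffop_mono.
Qed.

Lemma diffop_eta2 A : is_diffop A -> is_diffop (fun H => eta2 (A H)).
Proof.
move=> [N [a Aa]].
pose T l m : operator R := fun H =>
  eta2 (a l m) * iter l (@eta1 R) (iter m (@eta2 R) H)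
  + (stwist true (a l m) * ((-1) ^+ l : R)%:A)
    * iter l (@eta1 R) (iter m.+1 (@eta2 R) H).
apply: (@diffop_ext (fun H => \sum_(l < N) \sum_(m < N) T l m H)).
  move=> H; rewrite Aa linear_sum; apply: eq_bigr => l _; rewrite linear_sum.
  apply: eq_bigr => m _.
  by rewrite /= eta2M eta2_iter_eta1 /T -mulrA mulr_algl.
apply: (diffop_sum N (A := fun l H => \sum_(m < N) T l m H)) => l.
by apply: (diffop_sum N (A := T l)) => m; apply: diffopD; apply: diffop_mono.
Qed.

Lemma dx_eta1 H : dx H = - eta1 (eta1 H).
Proof. by rewrite !eta1E; apply: superfunP; rewrite /= ?cDN ?opprK. Qed.

Lemma d1E H : d1 H = eta1 H + th1 R * dx H.
Proof. by rewrite /eta1 subrK. Qed.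

Lemma d2E H : d2 H = eta2 H + th2 R * dx H.
Proof. by rewrite /eta2 subrK. Qed.

Lemma diffop_dx A : is_diffop A -> is_diffop (fun H => dx (A H)).
Proof.
move=> hA; apply: diffop_ext (diffopN (diffop_eta1 (diffop_eta1 hA))) => H.
by rewrite -dx_eta1.
Qed.

Lemma diffop_iter_dx n A : is_diffop A -> is_diffop (fun H => iter n (@dx R) (A H)).
Proof. by elim: n => //= n IHn /IHn; apply: diffop_dx. Qed.

Lemma diffop_d1 A : is_diffop A -> is_diffop (fun H => d1 (A H)).
Proof.
move=> hA; apply: diffop_ext (diffopD (diffop_eta1 hA)
  (diffopM (th1 R) (diffop_dx hA))) => H; exact/esym/d1E.
Qed.

Lemma diffop_d2 A : is_diffop A -> is_diffop (fun H => d2 (A H)).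
Proof.
move=> hA; apply: diffop_ext (diffopD (diffop_eta2 hA)
  (diffopM (th2 R) (diffop_dx hA))) => H; exact/esym/d2E.
Qed.

(** The parity involution is the differential operator
    (1 - 2 theta_1 d_1)(1 - 2 theta_2 d_2). *)
Lemma diffop_stwist A : is_diffop A -> is_diffop (fun H => stwist true (A H)).
Proof.
move=> hA; pose B H := A H + (-2) *: (th2 R * d2 (A H)).
have hB : is_diffop B.
  by apply: diffopD => //; apply/diffopZ/diffopM/diffop_d2.
apply: (@diffop_ext (fun H => B H + (-2) *: (th1 R * d1 (B H)))).
  move=> H; rewrite stwistE /B; move: (A H) => K.
  apply: superfunP; rewrite /= !scaleNr !scaler_nat; ring.
by apply: diffopD => //; apply/diffopZ/diffopM/diffop_d1.
Qed.

Definition dxn n H := SuperFun (cDn n (s0 H)) (cDn n (s1 H)) (cDn n (s2 H))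
  (cDn n (s12 H)).

Lemma iter_dx n H : iter n (@dx R) H = dxn n H.
Proof. by elim: n => [|n IHn] /=; [case: H|rewrite IHn]. Qed.

Lemma diffop_dxn n A : is_diffop A -> is_diffop (fun H => dxn n (A H)).
Proof.
by move=> /(diffop_iter_dx n); apply: diffop_ext => H; rewrite iter_dx.
Qed.

Lemma iter_eta1 n H : iter (2 * n) (@eta1 R) H = (-1) ^+ n *: dxn n H.
Proof.
rewrite -iter_dx; elim: n => [|n IHn]; first by rewrite scale1r.
rewrite mulnS !iterS IHn dx_eta1 !linearZ exprS /=.
by rewrite scalerN mulN1r scaleNr opprK.
Qed.

Lemma iter_eta2 n H : iter (2 * n) (@eta2 R) H = (-1) ^+ n *: dxn n H.
Proof.
have dx_eta2 K : dx K = - eta2 (eta2 K).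
  by rewrite !eta2E; apply: superfunP; rewrite /= ?cDN ?opprK.
rewrite -iter_dx; elim: n => [|n IHn]; first by rewrite scale1r.
rewrite mulnS !iterS IHn dx_eta2 !linearZ exprS /=.
by rewrite scalerN mulN1r scaleNr opprK.
Qed.

(** Through such a K, differential operators on superfunctions restrict to
    operators on the line, to which [scalar_diffop_weight] applies. *)
Definition scalar_components (K : Cinf R -> superfun R) :=
  [/\ scalar_diffop (fun h => s0 (K h)), scalar_diffop (fun h => s1 (K h)),
      scalar_diffop (fun h => s2 (K h)) & scalar_diffop (fun h => s12 (K h))].

Lemma scalar_components0 : scalar_components (fun=> 0).
Proof. by split; apply: scalar_diffop0. Qed.

Lemma scalar_componentsD K L : scalar_components K -> scalar_components L ->
  scalar_components (fun h => K h + L h).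
Proof. by move=> [????] [????]; split; apply: scalar_diffopD. Qed.

Lemma scalar_componentsM F K : scalar_components K ->
  scalar_components (fun h => F * K h).
Proof.
move=> [????]; split => /=; repeat apply: scalar_diffopD;
  by try apply: scalar_diffopN; apply: scalar_diffopM.
Qed.

Lemma scalar_components_eta1 K : scalar_components K ->
  scalar_components (fun h => eta1 (K h)).
Proof.
move=> [????]; split; under eq_fun do rewrite eta1E /=; rewrite //;
  by apply/scalar_diffopN/scalar_diffop_cD.
Qed.

Lemma scalar_components_eta2 K : scalar_components K ->
  scalar_components (fun h => eta2 (K h)).
Proof.
move=> [????]; split; under eq_fun do rewrite eta2E /=; rewrite //;
  by try apply: scalar_diffopN; try apply: scalar_diffop_cD.
Qed.

Lemma diffop_components A K : is_diffop A -> scalar_components K ->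
  scalar_components (fun h => A (K h)).
Proof.
move=> [N [a Aa]] hK; under eq_fun do rewrite Aa.
have sum (M : nat) (L : nat -> Cinf R -> superfun R) :
    (forall i, scalar_components (L i)) ->
    scalar_components (fun h => \sum_(i < M) L i h).
  move=> hL; elim: M => [|M IHM]; under eq_fun do rewrite ?big_ord0 ?big_ord_recr.
    exact: scalar_components0.
  exact: scalar_componentsD.
pose T l m h := a l m * iter l (@eta1 R) (iter m (@eta2 R) (K h)).
apply: (sum N (fun l h => \sum_(m < N) T l m h)) => l.
apply: (sum N (T l)) => m; apply: scalar_componentsM.
elim: l => [|l IHl]; last exact: scalar_components_eta1.
elim: m => [|m IHm] //=; exact: scalar_components_eta2.
Qed.

End DifferentialOperators.

(** * Relative cochains and their lowest weight vectors *)

Section RelativeCochains.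
Context (R : realType).
Implicit Types (a b c d k lam mu : R) (p q r : bool) (y z h : osp22 R).
Implicit Types (U : osp22 R -> operator R) (A v : operator R).
Local Notation X := (cX R).

Definition ev a b c d : osp22 R := Osp22 (osp_even_in a b c d).
Definition od a b c d : osp22 R := Osp22 (osp_odd_in a b c d).

Lemma ev_par a b c d : osp22_par false (ev a b c d).
Proof. by apply: superfunP. Qed.

Lemma od_par a b c d : osp22_par true (od a b c d).
Proof. by apply: superfunP. Qed.

Lemma par_evP y : osp22_par false y -> exists a b c d, y = ev a b c d.
Proof.
move=> /(osp22_evenP (genP y))[a [b [c [d yE]]]]; exists a, b, c, d.
exact: val_inj.
Qed.

Lemma par_odP y : osp22_par true y -> exists a b c d, y = od a b c d.
Proof.
move=> /(osp22_oddP (genP y))[a [b [c [d yE]]]]; exists a, b, c, d.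
exact: val_inj.
Qed.

Lemma osp12_ev a b c : osp12 (ev a b c 0).
Proof. exact: osp12_in_even. Qed.

Lemma osp12_od a b : osp12 (od a b 0 0).
Proof. exact: osp12_in_odd. Qed.

Lemma br_ev_ev a b c d a' b' c' d' : osp22_br (ev a b c d) (ev a' b' c' d')
  = ev ((a * b' - b * a') *+ 2) (a * c' - c * a') ((b * c' - c * b') *+ 2) 0.
Proof.
apply: val_inj; rewrite /= cbracket_ee; apply: superfunP;
  rewrite /= ?(constD, constN, constM, constMn, const0) ?cDE //; gring.
Qed.

Lemma br_ev_od a b c d a' b' c' d' : osp22_br (ev a b c d) (od a' b' c' d')
  = od (a * b' - b * a' + d * c') (b * b' - c * a' + d * d')
       (a * d' - b * c' - d * a') (b * d' - c * c' - d * b').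
Proof.
apply: val_inj; rewrite /= cbracket_eo; apply: superfunP;
  rewrite /= ?(constD, constN, constM, constMn, const0) ?cDE //; Cinf_ring.
Qed.

Lemma br_od_ev a b c d a' b' c' d' : osp22_br (od a' b' c' d') (ev a b c d)
  = od (- (a * b' - b * a' + d * c')) (- (b * b' - c * a' + d * d'))
       (- (a * d' - b * c' - d * a')) (- (b * d' - c * c' - d * b')).
Proof.
apply: val_inj; rewrite /= cbracket_oe; apply: superfunP;
  rewrite /= ?(constD, constN, constM, constMn, const0) ?cDE //; Cinf_ring.
Qed.

Lemma br_od_od a b c d a' b' c' d' : osp22_br (od a b c d) (od a' b' c' d')
  = ev ((a * a' + c * c') *+ 2) (a * b' + b * a' + c * d' + d * c')
       ((b * b' + d * d') *+ 2) (a * d' - c * b' - b * c' + d * a').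
Proof.
apply: val_inj; rewrite /= cbracket_oo; apply: superfunP;
  rewrite /= ?(constD, constN, constM, constMn, const0) ?cDE //; Cinf_ring.
Qed.

Lemma osp22_decomp y : exists a b c d e f g i,
  y = ev a b c 0 + od d e 0 0 + (f *: od 0 0 1 0 + g *: od 0 0 0 1
    + i *: ev 0 0 0 1).
Proof.
have /osp22P[a [b [c [d [e [f [g [h yE]]]]]]]] := genP y.
exists a, (b / 2), c, (d / 2), (e / 2), (f / 2), (g / 2), (h / 2).
have E (u : R) : const u = const (u / 2) *+ 2 by rewrite -constMn halfMn.
apply: val_inj; rewrite /= yE; apply: superfunP;
  rewrite /= ?(const0, const1) ?scale_const ?(E b) ?(E d) ?(E e) ?(E f) ?(E g)
    ?(E h); gring.
Qed.

Lemma opact0 lam mu F : opact lam mu F 0 = 0.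
Proof.
apply/funext => H; rewrite /opact linear0 big1 ?subr0 // => q _.
by rewrite /opart big_bool /= !linear0 addr0.
Qed.

Definition is_rel_cochain lam mu p U :=
  [/\ linear U, (forall h, osp12 h -> U h = 0) &
    (forall q h y, osp12 h -> osp22_par q h ->
     U (osp22_br h y) = (-1) ^+ (q && p) *: opact lam mu (gen h) (U y))].

Definition is_cocycle lam mu p U :=
  cochain1 (@osp22_par R) (@osp22_br R) (@osp12 R) (@diffop R)
    (fun G : osp22 R => opact lam mu (gen G)) (@diff_cochain R) p U /\
  delta1_eq0 (@osp22_par R) (@osp22_br R)
    (fun G : osp22 R => opact lam mu (gen G)) p U.

Lemma is_cocycle_rel lam mu p U : is_cocycle lam mu p U ->
  is_rel_cochain lam mu p U.
Proof. by move=> [[]]. Qed.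

(** g/k is generated over k by its lowest weight vector theta_2, so a k-map out
    of it is determined by the image of theta_2. *)
Lemma rel_cochain_eq0 lam mu p U : is_rel_cochain lam mu p U ->
  U (od 0 0 1 0) = 0 -> U = 0.
Proof.
move=> [Ul Uk Uact] U0; have [U00 UN UD UZ] := linear_additive Ul.
have U1 : U (od 0 0 0 1) = 0.
  have := Uact false (ev 0 0 1 0) (od 0 0 1 0)
    (osp12_ev _ _ _) (ev_par _ _ _ _).
  rewrite U0 opact0 scaler0 br_ev_od => E; apply: oppr_inj; rewrite -UN oppr0 -E.
  congr U; apply: val_inj; apply: superfunP;
    rewrite /= ?(mul0r, mulr0, mulr1, subr0, sub0r, add0r, addr0, oppr0)
      ?constN ?const0 ?const1; gring.
have U2 : U (ev 0 0 0 1) = 0.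
  have := Uact true (od 0 1 0 0) (od 0 0 1 0) (osp12_od _ _) (od_par _ _ _ _).
  rewrite U0 opact0 scaler0 br_od_od => E; apply: oppr_inj; rewrite -UN oppr0 -E.
  congr U; apply: val_inj; apply: superfunP;
    rewrite /= ?(mul0r, mulr0, mulr1, subr0, sub0r, add0r, addr0, oppr0, mul0rn)
      ?constN ?const0 ?const1; gring.
apply/funext => y.
have [a [b [c [d [e [f [g [i ->]]]]]]]] := osp22_decomp y.
rewrite !UD !UZ U0 U1 U2 !Uk ?scaler0 ?addr0 //; first exact: osp12_od.
exact: osp12_ev.
Qed.

End RelativeCochains.

(** * The lowest weight vectors *)

Section LowestWeight.
Context (R : realType).
Implicit Types (a b c d k lam mu : R) (p q r : bool) (m n : nat).
Implicit Types (F G H : superfun R) (B : operator R) (f h : Cinf R).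
Local Notation X := (cX R).

Let czero := (const0, mul0r, mulr0, mul0rn, addr0, add0r, subr0, sub0r, oppr0).

Lemma Lie_1 lam H : Lie lam (osp_even 1 0 0 0) H = dx H.
Proof.
by rewrite Lie_even; apply: superfunP; rewrite /= ?(czero, const1, mul1r).
Qed.

Lemma Lie_2x lam H : Lie lam (osp_even 0 1 0 0) H = SuperFun
  ((X * cD (s0 H)) *+ 2 + const (lam *+ 2) * s0 H)
  ((X * cD (s1 H)) *+ 2 + const (lam *+ 2 + 1) * s1 H)
  ((X * cD (s2 H)) *+ 2 + const (lam *+ 2 + 1) * s2 H)
  ((X * cD (s12 H)) *+ 2 + const (lam *+ 2 + 2) * s12 H).
Proof.
rewrite Lie_even; apply: superfunP;
  rewrite /= ?(czero, constD, constMn, const1, mul1r); gring.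
Qed.

Lemma Lie_x2 lam H : Lie lam (osp_even 0 0 1 0) H = SuperFun
  (X * (X * cD (s0 H)) + const (lam *+ 2) * (X * s0 H))
  (X * (X * cD (s1 H)) + const (lam *+ 2 + 1) * (X * s1 H))
  (X * (X * cD (s2 H)) + const (lam *+ 2 + 1) * (X * s2 H))
  (X * (X * cD (s12 H)) + const (lam *+ 2 + 2) * (X * s12 H)).
Proof.
rewrite Lie_even; apply: superfunP;
  rewrite /= ?(czero, constD, constMn, const1, mul1r); gring.
Qed.

Lemma Lie_2th1 lam H : Lie lam (osp_odd 1 0 0 0) H =
  SuperFun (s1 H) (cD (s0 H)) (s12 H) (cD (s2 H)).
Proof.
rewrite Lie_odd; apply: superfunP;
  by rewrite /= ?(czero, const1, mul1r).
Qed.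

Lemma Lie_2th2 lam H : Lie lam (osp_odd 0 0 1 0) H =
  SuperFun (s2 H) (- s12 H) (cD (s0 H)) (- cD (s1 H)).
Proof.
rewrite Lie_odd; apply: superfunP;
  by rewrite /= ?(czero, const1, mul1r).
Qed.

(** The relations satisfied by theta_2 under 1, 2x, x^2, 2 theta_1, 2 theta_2,
    transported to the value B of a relative cocycle at 2 theta_2. The factor
    in - B is the bracket {2x, theta_2} = - theta_2. *)
Definition lowest_weight lam mu q B :=
  [/\ is_diffop B /\ opart q B = B,
      opact lam mu (osp_even 1 0 0 0) B = 0 /\
      opact lam mu (osp_even 0 1 0 0) B = - B,
      opact lam mu (osp_even 0 0 1 0) (opact lam mu (osp_even 0 0 1 0) B) = 0 &
      opact lam mu (osp_odd 1 0 0 0) B = 0 /\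
      opact lam mu (osp_odd 0 0 1 0) B = 0].

(** Only the invariance under theta_2 uses the cocycle identity, at the pair
    (theta_2, theta_2): there {theta_2, theta_2} is in k, where the cochain
    vanishes. The rest is equivariance under k. *)
Lemma cocycle_lowest_weight lam mu p (U : osp22 R -> operator R) :
  is_cocycle lam mu p U -> lowest_weight lam mu (~~ p) (U (od 0 0 1 0)).
Proof.
move=> [[Ul _ Upar Uk Uact] Udelta]; have [U0 UN UD UZ] := linear_additive Ul.
have E y a b c : opact lam mu (osp_even a b c 0) (U y)
    = U (osp22_br (ev a b c 0) y).
  by rewrite (Uact false) ?expr0 ?scale1r //; exact: osp12_ev.
split.
- by have := Upar true (od 0 0 1 0) (od_par _ _ _ _); rewrite addbT => -[].
- rewrite !E !br_ev_od -UN -[X in _ /\ _ = X]/(U _) -U0.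
  split; congr U; apply: val_inj; apply: superfunP;
    rewrite /= ?(czero, constN, const1, mulr1, mul1r) //; gring.
- rewrite !E !br_ev_od -U0; congr U; apply: val_inj; apply: superfunP;
    rewrite /= ?(czero, constN, const1, mulr1, mul1r) //; gring.
split.
  have := Uact true (od 1 0 0 0) (od 0 0 1 0) (osp12_od _ _) (od_par _ _ _ _).
  rewrite br_od_od (_ : ev _ _ _ _ = 0) ?U0; last first.
    apply: val_inj; apply: superfunP;
      rewrite /= ?(czero, constN, const1, mulr1, mul1r) //; gring.
  by move=> /esym/eqP; rewrite scaler_eq0 signr_eq0 /= => /eqP.
have := Udelta true true (od 0 0 1 0) (od 0 0 1 0)
  (od_par _ _ _ _) (od_par _ _ _ _).
rewrite br_od_od (Uk (ev _ _ _ _)); last first.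
  rewrite (_ : ev _ _ _ _ = ev 2 0 0 0); first exact: osp12_ev.
  apply: val_inj; apply: superfunP;
    rewrite /= ?(czero, constN, const1, mulr1, mul1r, constMn) //.
rewrite subr0 addTb andTb; case: p {Upar Uact Udelta} => /=;
  rewrite ?expr0 ?expr1 ?scale1r ?scaleN1r ?opprK => /eqP.
  by rewrite -opprD oppr_eq0 -mulr2n -scaler_nat scaler_eq0 pnatr_eq0 => /eqP.
by rewrite -mulr2n -scaler_nat scaler_eq0 pnatr_eq0 => /eqP.
Qed.

(** The odd translations move every component to the theta-free one, and B
    supercommutes with them. *)
Lemma components_of_s0 lam mu q B : lowest_weight lam mu q B -> forall H,
  B H = SuperFun (s0 (B H)) ((-1) ^+ q *: s0 (B (Lie lam (osp_odd 1 0 0 0) H)))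
    ((-1) ^+ q *: s0 (B (Lie lam (osp_odd 0 0 1 0) H)))
    (s0 (B (Lie lam (osp_odd 0 0 1 0) (Lie lam (osp_odd 1 0 0 0) H)))).
Proof.
move=> [[Bd Bq] _ _ [B1 B2]] H; have Bl := diffop_linear Bd.
have E1 K : Lie mu (osp_odd 1 0 0 0) (B K)
    = (-1) ^+ q *: B (Lie lam (osp_odd 1 0 0 0) K).
  have := opact_hom lam mu K Bl Bq (od_par 1 0 0 0).
  by rewrite andbT B1 => /esym/eqP; rewrite subr_eq0 => /eqP.
have E2 K : Lie mu (osp_odd 0 0 1 0) (B K)
    = (-1) ^+ q *: B (Lie lam (osp_odd 0 0 1 0) K).
  have := opact_hom lam mu K Bl Bq (od_par 0 0 1 0).
  by rewrite andbT B2 => /esym/eqP; rewrite subr_eq0 => /eqP.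
have F1 K : s1 (B K) = (-1) ^+ q *: s0 (B (Lie lam (osp_odd 1 0 0 0) K)).
  by rewrite -s0Z -E1 Lie_2th1.
have F2 K : s2 (B K) = (-1) ^+ q *: s0 (B (Lie lam (osp_odd 0 0 1 0) K)).
  by rewrite -s0Z -E2 Lie_2th2.
apply: superfunP => //=.
have -> : s12 (B H) = s2 (Lie mu (osp_odd 1 0 0 0) (B H)) by rewrite Lie_2th1.
by rewrite E1 s2Z F2 scalerA -expr2 sqrr_sign scale1r.
Qed.

Definition in0 h : superfun R := SuperFun h 0 0 0.
Definition in1 h : superfun R := SuperFun 0 h 0 0.
Definition in2 h : superfun R := SuperFun 0 0 h 0.
Definition in12 h : superfun R := SuperFun 0 0 0 h.

Lemma in_sum H : H = in0 (s0 H) + in1 (s1 H) + in2 (s2 H) + in12 (s12 H).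
Proof. by apply: superfunP; rewrite /= ?addr0 ?add0r. Qed.

(** On the block j of superfunctions the Euler field 2x acts as
    2xD + 2 lam + e; comparison with its action 2xD + 2 mu on the theta-free
    part of the values gives the weight of the restriction to j. *)
Lemma lowest_weight_block lam mu q B (j : Cinf R -> superfun R) e :
  lowest_weight lam mu q B -> scalar_components j ->
  (forall h, Lie lam (osp_even 1 0 0 0) (j h) = j (cD h)) ->
  (forall h, Lie lam (osp_even 0 1 0 0) (j h)
     = 2 *: j (X * cD h) + (lam *+ 2 + e) *: j h) ->
  exists n c, (c != 0 -> (mu - lam) *+ 2 + 1 - e = n%:R *+ 2) /\
    forall h, s0 (B (j h)) = const c * cDn n h.
Proof.
move=> [[Bd Bq] [Bt Bw] _ _] jd jt jw; have Bl := diffop_linear Bd.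
have [B0 BN BD BZ] := linear_additive Bl.
have E (y : osp22 R) K : osp22_par false y ->
    Lie mu (gen y) (B K) - B (Lie lam (gen y) K) = opact lam mu (gen y) B K.
  by move=> yp; rewrite (opact_hom _ _ _ Bl Bq yp) andbF scale1r.
have [Td _ _ _] := diffop_components Bd jd.
have [h|h|n [c [w T]]] := @scalar_diffop_weight R (mu - lam + (1 - e) / 2) _ Td.
- have := E (ev 1 0 0 0) (j h) (ev_par _ _ _ _).
  rewrite /= Bt jt Lie_1 => /(congr1 (@s0 R)) /= /eqP.
  by rewrite subr_eq0 => /eqP.
- have := E (ev 0 1 0 0) (j h) (ev_par _ _ _ _).
  rewrite /= Bw jw Lie_2x BD !BZ => /(congr1 (@s0 R)) /=.
  move: (s0 (B (j h))) (s0 (B (j (X * cD h)))) => u v /eqP.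
  rewrite -subr_eq0 opprK scaler_nat !scale_const => /eqP W.
  have E2 : const e = 1 - const ((1 - e) / 2) *+ 2.
    by rewrite -constMn halfMn constD constN const1 opprB addrC subrK.
  have {}W : v *+ 2 = (X * cD u + const (mu - lam + (1 - e) / 2) * u) *+ 2.
    apply/eqP; rewrite -subr_eq0 -oppr_eq0; apply/eqP.
    by rewrite -W !(constD, constN, constMn) E2; gring.
  by rewrite -[v]const_half W const_half.
exists n, c; split=> // /w <-.
by rewrite [in RHS]mulrnDl halfMn addrA.
Qed.

(** The operator c d^n + d d^m eta_2 eta_1, in components. *)
Definition op_even n c m d : operator R := fun H => SuperFun
  (const c * cDn n (s0 H) + const d * cDn m (s12 H))
  (const c * cDn n (s1 H) + const d * cDn m.+1 (s2 H))
  (const c * cDn n (s2 H) - const d * cDn m.+1 (s1 H))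
  (const c * cDn n (s12 H) - const d * cDn m.+2 (s0 H)).

(** The operator c d^n eta_1 + d d^m eta_2, in components. *)
Definition op_odd n c m d : operator R := fun H => SuperFun
  (const c * cDn n (s1 H) + const d * cDn m (s2 H))
  (- (const c * cDn n.+1 (s0 H)) - const d * cDn m (s12 H))
  (const c * cDn n (s12 H) - const d * cDn m.+1 (s0 H))
  (const d * cDn m.+1 (s1 H) - const c * cDn n.+1 (s2 H)).

Let in_Lie e (j : Cinf R -> superfun R) lam :=
  (forall h, Lie lam (osp_even 1 0 0 0) (j h) = j (cD h)) /\
  (forall h, Lie lam (osp_even 0 1 0 0) (j h)
     = 2 *: j (X * cD h) + (lam *+ 2 + e) *: j h).

Let in0_Lie lam : in_Lie 0 in0 lam.
Proof.
split=> h; rewrite ?Lie_1 ?Lie_2x; apply: superfunP;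
  rewrite /= ?cD0 ?(czero, scaler0) ?scaler_nat ?scale_const ?czero //.
Qed.

Let in1_Lie lam : in_Lie 1 in1 lam.
Proof.
split=> h; rewrite ?Lie_1 ?Lie_2x; apply: superfunP;
  rewrite /= ?cD0 ?(czero, scaler0) ?scaler_nat ?scale_const ?czero //.
Qed.

Let in2_Lie lam : in_Lie 1 in2 lam.
Proof.
split=> h; rewrite ?Lie_1 ?Lie_2x; apply: superfunP;
  rewrite /= ?cD0 ?(czero, scaler0) ?scaler_nat ?scale_const ?czero //.
Qed.

Let in12_Lie lam : in_Lie 2 in12 lam.
Proof.
split=> h; rewrite ?Lie_1 ?Lie_2x; apply: superfunP;
  rewrite /= ?cD0 ?(czero, scaler0) ?scaler_nat ?scale_const ?czero //.
Qed.

Lemma in_components : [/\ scalar_components in0, scalar_components in1,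
  scalar_components in2 & scalar_components in12].
Proof.
by split; split=> /=; (exact: scalar_diffop_id || exact: scalar_diffop0).
Qed.

Lemma lowest_weight_even lam mu B : lowest_weight lam mu false B ->
  exists n c m d, [/\ c != 0 -> (mu - lam) *+ 2 + 1 = n%:R *+ 2,
    d != 0 -> (mu - lam) *+ 2 - 1 = m%:R *+ 2 & B = op_even n c m d].
Proof.
move=> Blw; have [D0 _ _ D12] := in_components.
have [n [c [nE B0]]] := lowest_weight_block Blw D0 (in0_Lie lam).1 (in0_Lie lam).2.
have [m [d [mE B12]]] :=
  lowest_weight_block Blw D12 (in12_Lie lam).1 (in12_Lie lam).2.
exists n, c, m, d; split=> [/nE|/mE|].
- by rewrite subr0.
- by move=> <-; ring.
have [[Bd Bq] _ _ _] := Blw; have Bl := diffop_linear Bd.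
have [_ _ BD _] := linear_additive Bl.
have odd0 K : spart true K = K -> s0 (B K) = 0.
  by move=> /(homop Bl Bq) => <-.
have E H : s0 (B H) = const c * cDn n (s0 H) + const d * cDn m (s12 H).
  rewrite {1}[H]in_sum !BD !s0D B0 B12 (odd0 (in1 _)) ?(odd0 (in2 _)).
  - by rewrite !addr0.
  - by apply: superfunP.
  - by apply: superfunP.
apply/funext => H; rewrite (components_of_s0 Blw) expr0 !scale1r !E.
by rewrite !Lie_2th2 !Lie_2th1; apply: superfunP;
  rewrite //= ?(cDnN, cDn_cD, cDnS) ?mulrN.
Qed.

Lemma lowest_weight_odd lam mu B : lowest_weight lam mu true B ->
  exists n c m d, [/\ c != 0 -> mu - lam = n%:R, d != 0 -> mu - lam = m%:R &
    B = op_odd n c m d].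
Proof.
move=> Blw; have [_ D1 D2 _] := in_components.
have [n [c [nE B1]]] := lowest_weight_block Blw D1 (in1_Lie lam).1 (in1_Lie lam).2.
have [m [d [mE B2]]] := lowest_weight_block Blw D2 (in2_Lie lam).1 (in2_Lie lam).2.
have half (k : nat) : (mu - lam) *+ 2 + 1 - 1 = k%:R *+ 2 -> mu - lam = k%:R.
  by rewrite addrK => /eqP; rewrite -subr_eq0 -mulrnBl mulrn_eq0 subr_eq0 => /eqP.
exists n, c, m, d; split=> [/nE/half|/mE/half|] //.
have [[Bd Bq] _ _ _] := Blw; have Bl := diffop_linear Bd.
have [_ _ BD _] := linear_additive Bl.
have even0 K : spart false K = K -> s0 (B K) = 0.
  by move=> /(homop Bl Bq) => <-.
have E H : s0 (B H) = const c * cDn n (s1 H) + const d * cDn m (s2 H).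
  rewrite {1}[H]in_sum !BD !s0D B1 B2 (even0 (in0 _)) ?(even0 (in12 _)).
  - by rewrite add0r addr0.
  - by apply: superfunP.
  - by apply: superfunP.
apply/funext => H; rewrite (components_of_s0 Blw) expr1 !E.
by rewrite !Lie_2th2 !Lie_2th1; apply: superfunP;
  rewrite //= ?(cDnN, cDn_cD, cDnS) ?scaleN1r ?mulrN ?opprD ?opprK // addrC.
Qed.

Lemma cD_Xpow (k : nat) : X * cD (X ^+ k) = const k%:R * X ^+ k.
Proof.
by case: k => [|k]; rewrite ?expr0 ?cD1 ?const0 ?mulr0 ?mul0r // cD_Xn exprS
  mulrCA.
Qed.

Lemma const_eq0 c : const c = 0 :> Cinf R -> c = 0.
Proof.
move=> c0; apply/eqP/negPn/negP => /const_inj0 cinj.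
by have /eqP := cinj _ (etrans (mulr1 _) c0); rewrite oner_eq0.
Qed.

(** In the square of the action of x^2 on B, evaluate on x^k, where D^(k+2) is the
    entry of B under consideration. The field raises the degree by one at each
    application, so D^(k+2) kills every term but the one where the field acts
    twice before it; there the two weight factors appear. *)
Lemma lowest_weight_sl2 lam mu q B (k : nat) (c e e' : R)
    (j : Cinf R -> superfun R) (pi : superfun R -> Cinf R) :
  lowest_weight lam mu q B ->
  (forall h, Lie lam (osp_even 0 0 1 0) (j h)
     = j (X * (X * cD h) + const (lam *+ 2 + e) * (X * h))) ->
  (forall K, pi (Lie mu (osp_even 0 0 1 0) K)
     = X * (X * cD (pi K)) + const (mu *+ 2 + e') * (X * pi K)) ->
  {morph pi : K L / K - L} -> pi 0 = 0 ->
  (forall h, pi (B (j h)) = const c * cDn k.+2 h) ->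
  c != 0 -> (k%:R + lam *+ 2 + e) * (k.+1%:R + lam *+ 2 + e) = 0.
Proof.
move=> [[Bd Bq] _ Bsl _] jx pix piB pi0 T c0; have Bl := diffop_linear Bd.
set F := osp_even 0 0 1 0 in jx pix Bsl.
have Fp : spart false F = F by exact: (ev_par 0 0 1 0).
have LX i : X * (X * cD (X ^+ i)) + const (lam *+ 2 + e) * (X * X ^+ i)
    = const (i%:R + lam *+ 2 + e) * X ^+ i.+1.
  rewrite cD_Xpow exprS !constD; gring.
have F2 := opact_hom lam mu _ (opact_linear lam mu F Bl)
  (opact_par lam mu Bl Bq Fp) Fp.
have := F2 (j (X ^+ k)); rewrite Bsl !(opact_hom _ _ _ Bl Bq Fp).
rewrite !andbF expr0 !scale1r => /(congr1 pi); rewrite !piB !pix !piB !pix.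
rewrite !jx !T LX.
have z i n : (i < n)%N -> cDn n (const (k%:R + lam *+ 2 + e) * X ^+ i) = 0.
  by move=> /(cDn_Xn0 R) in0; rewrite cDn_const in0 mulr0.
rewrite z // cDn_Xn0 // !(cD0, mulr0, addr0, subr0) sub0r opprB subr0.

have -> : X * (X * cD (const (k%:R + lam *+ 2 + e) * X ^+ k.+1))
     + const (lam *+ 2 + e) * (X * (const (k%:R + lam *+ 2 + e) * X ^+ k.+1))
   = const (k%:R + lam *+ 2 + e) * (const (k.+1%:R + lam *+ 2 + e) * X ^+ k.+2).
  by rewrite -(LX k.+1) cD_constM; gring.
rewrite !cDn_const cDn_Xn -!constM => /(etrans (esym pi0)) /esym /const_eq0.
by move=> /eqP; rewrite mulf_eq0 (negPf c0) /= mulrA mulf_eq0 pnatr_eq0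
  -[(_`! == 0)%N]negbK -lt0n fact_gt0 orbF => /eqP.
Qed.

Let in_x2 lam : [/\
  forall h, Lie lam (osp_even 0 0 1 0) (in0 h)
    = in0 (X * (X * cD h) + const (lam *+ 2 + 0) * (X * h)),
  forall h, Lie lam (osp_even 0 0 1 0) (in1 h)
    = in1 (X * (X * cD h) + const (lam *+ 2 + 1) * (X * h)),
  forall h, Lie lam (osp_even 0 0 1 0) (in2 h)
    = in2 (X * (X * cD h) + const (lam *+ 2 + 1) * (X * h)) &
  forall h, Lie lam (osp_even 0 0 1 0) (in12 h)
    = in12 (X * (X * cD h) + const (lam *+ 2 + 2) * (X * h))].
Proof.
by split=> h; rewrite Lie_x2; apply: superfunP; rewrite /= ?cD0 ?czero.
Qed.

Let x2_s mu : [/\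
  forall K, s0 (Lie mu (osp_even 0 0 1 0) K)
    = X * (X * cD (s0 K)) + const (mu *+ 2 + 0) * (X * s0 K),
  forall K, s1 (Lie mu (osp_even 0 0 1 0) K)
    = X * (X * cD (s1 K)) + const (mu *+ 2 + 1) * (X * s1 K),
  forall K, s2 (Lie mu (osp_even 0 0 1 0) K)
    = X * (X * cD (s2 K)) + const (mu *+ 2 + 1) * (X * s2 K) &
  forall K, s12 (Lie mu (osp_even 0 0 1 0) K)
    = X * (X * cD (s12 K)) + const (mu *+ 2 + 2) * (X * s12 K)].
Proof. by split=> K; rewrite Lie_x2 /= ?addr0. Qed.

(** For n >= 2, the entries of c D^n at 1 and at theta_1 theta_2 give, with
    t = n - 2 + 2 lam, the equations t (t + 1) = 0 and (t + 2) (t + 3) = 0. *)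
Lemma op_even_left lam mu n c m d : lowest_weight lam mu false (op_even n c m d) ->
  c != 0 -> (n <= 1)%N.
Proof.
move=> Blw c0; case: n Blw => [|[|n]] // Blw; exfalso.
have [x0 _ _ x12] := in_x2 lam; have [y0 _ _ y12] := x2_s mu.
have T0 h : s0 (op_even n.+2 c m d (in0 h)) = const c * cDn n.+2 h.
  by rewrite /= ?(cDn_0, cD0, mulr0, addr0, subr0, sub0r, constN, mulNr).
have T12 h : s12 (op_even n.+2 c m d (in12 h)) = const c * cDn n.+2 h.
  by rewrite /= ?(cDn_0, cD0, mulr0, addr0, subr0, sub0r, constN, mulNr).
have /eqP := lowest_weight_sl2 Blw x0 y0 (fun _ _ => erefl) erefl T0 c0.
have /eqP := lowest_weight_sl2 Blw x12 y12 (fun _ _ => erefl) erefl T12 c0.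
by rewrite -natr1 !mulf_eq0 => /orP[]/eqP ? /orP[]/eqP ?; lra.
Qed.

(** The entry of D^m eta_2 eta_1 from 1 to theta_1 theta_2 has order m + 2, enough
    for [lowest_weight_sl2] even when m = 0. *)
Lemma op_even_right lam mu n c m d :
  lowest_weight lam mu false (op_even n c m d) -> d != 0 ->
  lam = - (m%:R / 2) \/ lam = - (m.+1%:R / 2).
Proof.
move=> Blw d0; have nd0 : - d != 0 by rewrite oppr_eq0.
have [x0 _ _ _] := in_x2 lam; have [_ _ _ y12] := x2_s mu.
have T h : s12 (op_even n c m d (in0 h)) = const (- d) * cDn m.+2 h.
  by rewrite /= ?(cDn_0, cD0, mulr0, addr0, subr0, sub0r, constN, mulNr).
have /eqP := lowest_weight_sl2 Blw x0 y12 (fun _ _ => erefl) erefl T nd0.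
by rewrite -natr1 mulf_eq0 => /orP[]/eqP ?; [left|right]; lra.
Qed.

(** Two entries of D^n eta_i have order n + 1, on densities whose weights differ
    by 1/2; lam = - n/2 is the common root of the two quadratic equations. *)
Lemma op_odd_weight lam mu n c m d :
  lowest_weight lam mu true (op_odd n c m d) ->
  (c != 0 -> (0 < n)%N -> lam = - (n%:R / 2)) /\
  (d != 0 -> (0 < m)%N -> lam = - (m%:R / 2)).
Proof.
move=> Blw; have [x0 x1 x2 x12] := in_x2 lam; have [y0 y1 y2 y12] := x2_s mu.
split=> [c0|d0].
  case: n Blw => // n Blw _; have nc0 : - c != 0 by rewrite oppr_eq0.
  have T1 h : s1 (op_odd n.+1 c m d (in0 h)) = const (- c) * cDn n.+2 h.
    by rewrite /= ?(cDn_0, cD0, mulr0, addr0, subr0, sub0r, constN, mulNr).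
  have T2 h : s12 (op_odd n.+1 c m d (in2 h)) = const (- c) * cDn n.+2 h.
    by rewrite /= ?(cDn_0, cD0, mulr0, addr0, subr0, sub0r, constN, mulNr).
  have /eqP := lowest_weight_sl2 Blw x0 y1 (fun _ _ => erefl) erefl T1 nc0.
  have /eqP := lowest_weight_sl2 Blw x2 y12 (fun _ _ => erefl) erefl T2 nc0.
  by rewrite -natr1 !mulf_eq0 => /orP[]/eqP ? /orP[]/eqP ?; lra.
case: m Blw => // m Blw _; have nd0 : - d != 0 by rewrite oppr_eq0.
have T1 h : s2 (op_odd n c m.+1 d (in0 h)) = const (- d) * cDn m.+2 h.
  by rewrite /= ?(cDn_0, cD0, mulr0, addr0, subr0, sub0r, constN, mulNr).
have T2 h : s12 (op_odd n c m.+1 d (in1 h)) = const d * cDn m.+2 h.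
  by rewrite /= ?(cDn_0, cD0, mulr0, addr0, subr0, sub0r, constN, mulNr).
have /eqP := lowest_weight_sl2 Blw x0 y2 (fun _ _ => erefl) erefl T1 nd0.
have /eqP := lowest_weight_sl2 Blw x1 y12 (fun _ _ => erefl) erefl T2 d0.
by rewrite -natr1 !mulf_eq0 => /orP[]/eqP ? /orP[]/eqP ?; lra.
Qed.

End LowestWeight.

(** * Coboundaries of invariant operators *)

Section Coboundaries.
Context (R : realType).
Implicit Types (a b c d e k lam mu : R) (p q r : bool) (y z h : osp22 R).
Implicit Types (U : osp22 R -> operator R) (A v : operator R) (H : superfun R).
Local Notation X := (cX R).

Lemma opact_linearA lam mu (F : superfun R) : linear (opact lam mu F).
Proof.
move=> k A v; apply/funext => H; rewrite /opact -[RHS]/(k *: _ + _).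
rewrite -[(k *: A + v) H]/(k *: A H + v H) linearP /=.
rewrite scalerBr addrACA; congr (_ + _); rewrite -opprD; congr (- _).
rewrite scaler_sumr -big_split; apply: eq_bigr => q _ /=.
rewrite /opart scaler_sumr -big_split; apply: eq_bigr => s _ /=.
by rewrite -[(k *: A + v) _]/(k *: A _ + v _) linearP.
Qed.

Lemma is_rel_cochain_lin lam mu p k U U' : is_rel_cochain lam mu p U ->
  is_rel_cochain lam mu p U' -> is_rel_cochain lam mu p (k *: U + U').
Proof.
move=> [Ul U0 Ua] [Ul' U0' Ua'].
have E y : (k *: U + U') y = k *: U y + U' y by [].
split.
- move=> l y z; rewrite !E Ul Ul'.
  move: (U y) (U z) (U' y) (U' z) => u u' w w'.
  by rewrite !scalerDr !scalerA [k * l]mulrC addrACA.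
- by move=> h hk; rewrite E U0 // U0' // scaler0 addr0.
- move=> q h y hk hq; rewrite E (Ua q) // (Ua' q) //.
  have -> : opact lam mu (gen h) ((k *: U + U') y)
      = k *: opact lam mu (gen h) (U y) + opact lam mu (gen h) (U' y).
    exact: opact_linearA.
  move: (opact _ _ _ (U y)) (opact _ _ _ (U' y)) ((-1) ^+ _) => u w e.
  by rewrite scalerDr !scalerA mulrC.
Qed.

Definition rel_invariant lam mu p v := cochain0 (@osp12 R) (@diffop R)
  (fun G : osp22 R => opact lam mu (gen G)) p v.

Lemma diffop_lin p k A v : diffop p A -> diffop p v -> diffop p (k *: A + v).
Proof.
move=> [Ad Ap] [vd vp]; have kAv := diffopD (diffopZ k Ad) vd.
split; first exact: kAv.
apply: opart_hom; first exact: (diffop_linear kAv).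
move=> t H hH; rewrite -[(k *: A + v) H]/(k *: A H + v H) linearP /=.
by rewrite !homop //; exact: diffop_linear.
Qed.

Lemma rel_invariant_lin lam mu p k A v : rel_invariant lam mu p A ->
  rel_invariant lam mu p v -> rel_invariant lam mu p (k *: A + v).
Proof.
move=> [Ad A0] [vd v0]; split; first exact: diffop_lin.
by move=> h hk; rewrite opact_linearA A0 // v0 // scaler0 addr0.
Qed.

Lemma rel_invariant0 lam mu p : rel_invariant lam mu p 0.
Proof.
split=> [|h _]; last exact: opact0.
split; first exact: diffop0.
apply: opart_hom; first exact: (diffop_linear (diffop0 R)).
by move=> t H _; rewrite linear0.
Qed.

Lemma osp12_decomp h : osp12 h -> exists a b c d e,
  h = ev a b c 0 + od d e 0 0.
Proof.
move=> /osp12P[a [b [c [d [e hE]]]]]; exists a, (b / 2), c, (d / 2), (e / 2).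
have E (u : R) : const u = const (u / 2) *+ 2 by rewrite -constMn halfMn.
apply: val_inj; rewrite /= hE; apply: superfunP;
  rewrite /= ?const0 ?(E b) ?(E d) ?(E e); gring.
Qed.

(** The coboundary of v. The twist extends its sign (-1)^(|g||v|) linearly to
    elements g of mixed parity. *)
Definition delta0 lam mu p v : osp22 R -> operator R :=
  fun y => opact lam mu (stwist p (gen y)) v.

Lemma delta0_hom lam mu p q v y : linear v -> osp22_par q y ->
  delta0 lam mu p v y = (-1) ^+ (q && p) *: opact lam mu (gen y) v.
Proof.
move=> vl yq; rewrite /delta0 (stwist_hom p yq) andbC.
by have [_ _ _ ->] := linear_additive (opact_linearl lam mu vl).
Qed.

Lemma delta0_linear lam mu p v : linear v -> linear (delta0 lam mu p v).
Proof.
move=> vl k y z; rewrite /delta0 -[gen (k *: y + z)]/(k *: gen y + gen z).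
by rewrite linearP opact_linearl.
Qed.

Lemma delta0P lam mu p v : linear v ->
  is_delta0 (@osp22_par R) (fun G : osp22 R => opact lam mu (gen G)) p v
    (delta0 lam mu p v).
Proof.
by move=> vl; split; [exact: delta0_linear|move=> q y; exact: delta0_hom].
Qed.

Lemma delta0_0 lam mu p : delta0 lam mu p 0 = 0.
Proof. by apply/funext => y; exact: opact0. Qed.

Lemma delta0_osp12 lam mu p v h : rel_invariant lam mu p v -> osp12 h ->
  delta0 lam mu p v h = 0.
Proof.
move=> [[vd _] v0] /osp12_decomp[a [b [c [d [e ->]]]]].
have vl := diffop_linear vd.
have [_ _ -> _] := linear_additive (delta0_linear lam mu p vl).
rewrite (delta0_hom _ _ _ vl (ev_par _ _ _ _)).
rewrite (delta0_hom _ _ _ vl (od_par _ _ _ _)).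
by rewrite !v0 ?scaler0 ?addr0 //; [exact: osp12_od|exact: osp12_ev].
Qed.

Lemma cbracket_linear (F : superfun R) : linear (cbracket F).
Proof.
move=> k G H; rewrite !cbracketE !contactE; apply: superfunP;
  rewrite /= !linearP /= !scale_const; Cinf_ring.
Qed.

Lemma br_linear h : linear (osp22_br h).
Proof. by move=> k y z; apply: val_inj; exact: cbracket_linear. Qed.

Lemma br_par q r h y : osp22_par q h -> osp22_par r y ->
  osp22_par (q (+) r) (osp22_br h y).
Proof.
case: q; case: r.
- move=> /par_odP[a [b [c [d ->]]]] /par_odP[a' [b' [c' [d' ->]]]].
  by rewrite br_od_od; exact: ev_par.
- move=> /par_odP[a [b [c [d ->]]]] /par_evP[a' [b' [c' [d' ->]]]].
  by rewrite br_od_ev; exact: od_par.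
- move=> /par_evP[a [b [c [d ->]]]] /par_odP[a' [b' [c' [d' ->]]]].
  by rewrite br_ev_od; exact: od_par.
- move=> /par_evP[a [b [c [d ->]]]] /par_evP[a' [b' [c' [d' ->]]]].
  by rewrite br_ev_ev; exact: ev_par.
Qed.

Lemma par_decomp y : exists y0 y1,
  [/\ osp22_par false y0, osp22_par true y1 & y = y0 + y1].
Proof.
have [a [b [c [d [e [f [g [i ->]]]]]]]] := osp22_decomp y.
exists (ev a b c 0 + i *: ev 0 0 0 1).
exists (od d e 0 0 + (f *: od 0 0 1 0 + g *: od 0 0 0 1)); split.
- by apply: superfunP; rewrite /= ?scaler0 ?addr0.
- by apply: superfunP; rewrite /= ?scaler0 ?addr0.
- by rewrite [RHS]addrACA; congr (_ + _); exact: addrC.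
Qed.

(** Since v is killed by h, acting on v by {h, y} is acting by y and then by h. *)
Lemma delta0_equivariant lam mu p v q h y : rel_invariant lam mu p v ->
  osp12 h -> osp22_par q h -> delta0 lam mu p v (osp22_br h y)
    = (-1) ^+ (q && p) *: opact lam mu (gen h) (delta0 lam mu p v y).
Proof.
move=> [[vd vp] v0] hk hq; have vl := diffop_linear vd.
have [_ _ dD _] := linear_additive (delta0_linear lam mu p vl).
have [_ _ aD aZ] := linear_additive (opact_linearA lam mu (gen h)).
have hom r z : osp22_par r z -> delta0 lam mu p v (osp22_br h z)
    = (-1) ^+ (q && p) *: opact lam mu (gen h) (delta0 lam mu p v z).
  move=> zr; rewrite (delta0_hom _ _ _ vl (br_par hq zr)).
  rewrite (delta0_hom _ _ _ vl zr) (opact_cbracket _ _ vl vp hq zr) (v0 h hk).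
  rewrite opact0 scaler0 subr0 aZ scalerA; congr (_ *: _).
  by case: (q); case: (r); case: (p); rewrite /= ?mulr1 ?mul1r ?expr1 ?mulrNN ?mulr1.
have [y0 [y1 [/hom E0 /hom E1 ->]]] := par_decomp y.
have [_ _ brD _] := linear_additive (br_linear h).
rewrite brD dD E0 E1 [in RHS]dD -scalerDr; congr (_ *: _).
exact/esym/aD.
Qed.

Lemma delta0_rel_cochain lam mu p v : rel_invariant lam mu p v ->
  is_rel_cochain lam mu p (delta0 lam mu p v).
Proof.
move=> vinv; split; first exact: delta0_linear (diffop_linear vinv.1.1).
  by move=> h; exact: delta0_osp12.
by move=> q h y; exact: delta0_equivariant.
Qed.

Lemma rel_cochain_delta0 lam mu p U v :
  is_rel_cochain lam mu p U -> rel_invariant lam mu p v ->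
  U (od 0 0 1 0) = (-1) ^+ p *: opact lam mu (osp_odd 0 0 1 0) v ->
  U = delta0 lam mu p v.
Proof.
move=> Urel vinv U0; have vl := diffop_linear vinv.1.1.
suff E : - 1 *: delta0 lam mu p v + U = 0.
  by rewrite -[U](addKr (- 1 *: delta0 lam mu p v)) E addr0 scaleN1r opprK.
apply: (@rel_cochain_eq0 _ lam mu p).
  exact: is_rel_cochain_lin (delta0_rel_cochain vinv) Urel.
rewrite -[LHS]/(- 1 *: delta0 lam mu p v _ + U _) U0.
by rewrite (delta0_hom _ _ _ vl (od_par _ _ _ _)) scaleN1r addNr.
Qed.

End Coboundaries.

(** * The osp(1|2)-invariant operators *)

Section Invariants.
Context (R : realType).
Implicit Types (a b c d k lam mu : R) (p q r : bool) (n : nat).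
Implicit Types (v : operator R) (H : superfun R).
Local Notation X := (cX R).

Lemma diffop_par p v : is_diffop v -> (forall t H, spart t H = H ->
  spart (p (+) t) (v H) = v H) -> diffop p v.
Proof. by move=> vd vp; split=> //; apply: opart_hom vp; exact: diffop_linear. Qed.

Lemma invariantP lam mu p v : diffop p v ->
  (forall a b c H, Lie mu (osp_even a b c 0) (v H)
     = v (Lie lam (osp_even a b c 0) H)) ->
  (forall a b H, Lie mu (osp_odd a b 0 0) (v H)
     = (-1) ^+ p *: v (Lie lam (osp_odd a b 0 0) H)) ->
  rel_invariant lam mu p v.
Proof.
move=> vdp ve vo; split=> // h /osp12_decomp[a [b [c [d [e ->]]]]].
have [vd vp] := vdp; have vl := diffop_linear vd.
have [_ _ lD _] := linear_additive (opact_linearl lam mu vl).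
rewrite lD /=; apply/funext => H; rewrite -[LHS]/(opact _ _ _ _ H + opact _ _ _ _ H).
rewrite (opact_hom _ _ _ vl vp (ev_par a b c 0)).
rewrite (opact_hom _ _ _ vl vp (od_par d e 0 0)).
by rewrite /= ve vo andbF andbT expr0 scale1r !subrr addr0.
Qed.

(** For k, the densities of weight lam split into f + f_1 theta_1, of weight lam
    on the superline of dimension 1|1, and theta_2 times such a function, of
    weight lam + 1/2. Each operator below is a projection onto one summand,
    followed by the identity or by an odd power of eta_1, followed by an
    embedding; the digits number the source and the target summand. *)
Definition inv_id22 : operator R := fun H => SuperFun 0 0 (s2 H) (s12 H).
Definition inv_id12 : operator R := fun H => SuperFun 0 0 (s0 H) (- s1 H).
Definition inv_id21 : operator R := fun H => SuperFun (s2 H) (- s12 H) 0 0.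
Definition inv_eta12 n : operator R := fun H =>
  SuperFun 0 0 (cDn n (s1 H)) (cD (cDn n (s0 H))).
Definition inv_eta11 n : operator R := fun H =>
  SuperFun (cDn n (s1 H)) (- cD (cDn n (s0 H))) 0 0.
Definition inv_eta22 n : operator R := fun H =>
  SuperFun 0 0 (cDn n (s12 H)) (- cD (cDn n (s2 H))).

Ltac parity_solve := case=> H <-; apply: superfunP;
  rewrite /spart /= ?cDn_0 ?cD0 ?oppr0.

Lemma inv_id22_diffop : diffop false inv_id22.
Proof.
apply: diffop_par; last by parity_solve.
apply: diffop_ext (diffopM (th2 R) (diffop_d2 (diffop_id R))) => H.
by apply: superfunP; rewrite /=; ring.
Qed.

Lemma inv_id12_diffop : diffop true inv_id12.
Proof.
apply: diffop_par; last by parity_solve.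
apply: diffop_ext (diffopM (th2 R) (diffop_id R)) => H.
by apply: superfunP; rewrite /=; ring.
Qed.

Lemma inv_id21_diffop : diffop true inv_id21.
Proof.
apply: diffop_par; last by parity_solve.
exact: (diffop_d2 (diffop_id R)).
Qed.

Lemma inv_eta12_diffop n : diffop false (inv_eta12 n).
Proof.
apply: diffop_par; last by parity_solve.
apply: diffop_ext (diffopM (th2 R) (diffop_dxn n (diffop_eta1 (diffop_id R)))) => H.
rewrite eta1E; apply: superfunP; rewrite /= ?(cDnN, cDn_cD); ring.
Qed.

Lemma inv_eta11_diffop n : diffop true (inv_eta11 n).
Proof.
apply: diffop_par; last by parity_solve.
apply: diffop_ext (diffop_dxn n (diffop_eta1 (diffop_d2
  (diffopM (th2 R) (diffop_id R))))) => H.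
rewrite eta1E; apply: superfunP;
  rewrite /= ?(mul0r, mul1r, add0r, addr0, subr0, sub0r, opprK);
  by rewrite ?(cDnN, cDn_cD, cD0, oppr0, cDn_0).
Qed.

Lemma inv_eta22_diffop n : diffop true (inv_eta22 n).
Proof.
apply: diffop_par; last by parity_solve.
apply: diffop_ext (diffop_dxn n (diffop_eta1
  (diffopM (th2 R) (diffop_d2 (diffop_id R))))) => H.
rewrite eta1E; apply: superfunP;
  rewrite /= ?(mul0r, mul1r, add0r, addr0, subr0, sub0r, mulrN, opprK);
  by rewrite ?(cDnN, cDn_cD, cD0, oppr0, cDn_0).
Qed.

Ltac invariance_solve :=
  rewrite ?Lie_even ?Lie_odd; apply: superfunP;
  rewrite ?expr0 ?expr1 ?scale1r ?scaleN1r /=;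
  rewrite ?(cDnE, cDn'E, cDE); rewrite ?(cDnE, cDn'E, cDE);
  rewrite ?(constD, constN, constM, const0, const1);
  repeat match goal with
  | |- context [cD ?f] => move: (cD f) => ?
  | |- context [cDn'' ?n ?f] => move: (cDn'' n f) => ?
  | |- context [cDn' ?n ?f] => move: (cDn' n f) => ?
  | |- context [cDn ?n ?f] => move: (cDn n f) => ?
  | |- context [const ?a] =>
      lazymatch a with GRing.inv _ => fail | _ => move: (const a) => ? end
  end; Cinf_ring.

Lemma inv_id22_invariant lam : rel_invariant lam lam false inv_id22.
Proof.
apply: invariantP (inv_id22_diffop) _ _ => [a b c H|a b H];
  invariance_solve.
Qed.

Lemma inv_id12_invariant lam : rel_invariant lam (lam - 1 / 2) true inv_id12.
Proof.
apply: invariantP (inv_id12_diffop) _ _ => [a b c H|a b H];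
  invariance_solve.
Qed.

Lemma inv_id21_invariant lam : rel_invariant lam (lam + 1 / 2) true inv_id21.
Proof.
apply: invariantP (inv_id21_diffop) _ _ => [a b c H|a b H];
  invariance_solve.
Qed.

Lemma inv_eta12_invariant n :
  rel_invariant (- (n%:R / 2)) (n%:R / 2) false (inv_eta12 n).
Proof.
apply: invariantP (inv_eta12_diffop n) _ _ => [a b c H|a b H];
  invariance_solve.
Qed.

Lemma inv_eta11_invariant n :
  rel_invariant (- (n%:R / 2)) (n%:R / 2 + 1 / 2) true (inv_eta11 n).
Proof.
apply: invariantP (inv_eta11_diffop n) _ _ => [a b c H|a b H];
  invariance_solve.
Qed.

Lemma inv_eta22_invariant n :
  rel_invariant (- (n%:R / 2 + 1 / 2)) (n%:R / 2) true (inv_eta22 n).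
Proof.
apply: invariantP (inv_eta22_diffop n) _ _ => [a b c H|a b H];
  invariance_solve.
Qed.

End Invariants.

(** * Bilinear differential operators *)

Section DifferentialCochains.
Context (R : realType).
Implicit Types (F G H : superfun R) (U V : osp22 R -> operator R).
Implicit Types (Q : operator R).

Let S4 (N : nat) (F : nat -> nat -> nat -> nat -> superfun R) :=
  \sum_(i < N) \sum_(j < N) \sum_(l < N) \sum_(m < N) F i j l m.

Let sum_widen_if (N K : nat) (F : nat -> superfun R) : (N <= K)%N ->
  \sum_(i < N) F i = \sum_(i < K) if (i < N)%N then F i else 0.
Proof. by move=> NK; rewrite (big_ord_widen K F NK) big_mkcond. Qed.

Let S4_widen (N K : nat) (T : nat -> nat -> nat -> nat -> superfun R) :
  (N <= K)%N -> S4 N T = S4 K (fun i j l m =>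
  if [&& i < N, j < N, l < N & m < N]%N then T i j l m else 0).
Proof.
move=> NK; pose T1 i j l := \sum_(m < N) T i j l m.
pose T2 i j := \sum_(l < N) T1 i j l; pose T3 i := \sum_(j < N) T2 i j.
rewrite /S4 (sum_widen_if T3 NK).
apply: eq_bigr => i _; case: ifP => iN /=; last by do 3!rewrite big1 // => ? _.
rewrite /T3 (sum_widen_if (T2 i) NK).
apply: eq_bigr => j _; case: ifP => jN /=; last by do 2!rewrite big1 // => ? _.
rewrite /T2 (sum_widen_if (T1 i j) NK).
apply: eq_bigr => l _; case: ifP => lN /=; last by rewrite big1.
by rewrite /T1 (sum_widen_if (T i j l) NK).
Qed.

Definition linear_diff_cochain U :=
  [/\ linear U, diff_cochain U & forall y, is_diffop (U y)].

Lemma linear_diff_cochain_ext U V : (forall y H, U y H = V y H) ->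
  linear_diff_cochain U -> linear_diff_cochain V.
Proof. by move=> E; rewrite (_ : U = V) //; do 2!apply/funext => ?. Qed.

(** The building blocks of the two families; Q may involve the sign (-1)^|G|,
    by [diffop_stwist]. *)
Lemma linear_diff_cochain_mono Q l m : is_diffop Q -> linear_diff_cochain
  (fun y H => Q (gen y) * iter l (@eta1 R) (iter m (@eta2 R) H)).
Proof.
move=> Qd; split=> [k y z||y]; last exact: diffop_mono.
- apply/funext => H; rewrite -[gen (k *: y + z)]/(k *: gen y + gen z).
  by rewrite (diffop_linear Qd) mulrDl -scalerAl.
have [N [b bE]] := Qd; pose K := maxn N (maxn l m).+1.
have NK : (N <= K)%N by exact: leq_maxl.
have lK : (l < K)%N by rewrite leq_max ltnS leq_maxl orbT.
have mK : (m < K)%N by rewrite leq_max ltnS leq_maxr orbT.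
exists K, (fun i j l' m' => if [&& i < N, j < N, l' == l & m' == m]%N
  then b i j else 0) => y H.
rewrite bE mulr_suml; set e := iter l _ _; pose f i j := b i j
  * iter i (@eta1 R) (iter j (@eta2 R) (gen y)).
rewrite (sum_widen_if (fun i => (\sum_(j < N) f i j) * e) NK).
apply: eq_bigr => i _; case: ifP => iN /=; last first.
  by do 3!rewrite big1 // => ? _; rewrite !mul0r.
rewrite mulr_suml (sum_widen_if (fun j => f i j * e) NK).
apply: eq_bigr => j _; case: ifP => jN /=; last first.
  by do 2!rewrite big1 // => ? _; rewrite !mul0r.
rewrite (bigD1 (Ordinal lK)) //= (bigD1 (Ordinal mK)) //= !eqxx /=.
rewrite big1 ?addr0 => [|i' im]; last first.
  by rewrite (negPf im : (i' == m :> nat) = false) !mul0r.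
rewrite big1 ?addr0 // => i' il; apply: big1 => j' _.
by rewrite (negPf il : (i' == l :> nat) = false) !mul0r.
Qed.

Lemma linear_diff_cochainD U V : linear_diff_cochain U -> linear_diff_cochain V ->
  linear_diff_cochain (fun y H => U y H + V y H).
Proof.
move=> [Ul [N [a aE]] Ud] [Vl [M [b bE]] Vd]; split=> [k y z||y].
- apply/funext => H; rewrite Ul Vl -[RHS]/(k *: (_ + _) + (_ + _)).
  by rewrite scalerDr addrACA.
- pose t K (c : nat -> nat -> nat -> nat -> superfun R) i j l m :=
    if [&& i < K, j < K, l < K & m < K]%N then c i j l m else 0.
  exists (maxn N M), (fun i j l m => t N a i j l m + t M b i j l m) => y H.
  pose e i j l m := iter i (@eta1 R) (iter j (@eta2 R) (gen y))
    * iter l (@eta1 R) (iter m (@eta2 R) H).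
  have wE K L (c : nat -> nat -> nat -> nat -> superfun R) : (K <= L)%N ->
      S4 K (fun i j l m => c i j l m * e i j l m)
      = S4 L (fun i j l m => t K c i j l m * e i j l m).
    move=> KL; rewrite (S4_widen _ KL); do 4!apply: eq_bigr => ? _.
    by rewrite /t; case: ifP; rewrite ?mul0r.
  rewrite aE bE; transitivity (S4 N (fun i j l m => a i j l m * e i j l m)
      + S4 M (fun i j l m => b i j l m * e i j l m)).
    by congr (_ + _); do 4!apply: eq_bigr => ? _; rewrite mulrA.
  rewrite (wE _ _ _ (leq_maxl N M)) (wE _ _ _ (leq_maxr N M)) /S4.
  do 4!(rewrite -big_split; apply: eq_bigr => ? _).
  by rewrite -[RHS]mulrA mulrDl.
- exact: diffopD.
Qed.

Lemma Ups_diag_cochain lam : linear_diff_cochain (Ups_diag lam).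
Proof.
have Gd := diffop_id R; have sGd := diffop_stwist Gd.
have D0 := linear_diff_cochain_mono 0 0
  (diffopZ (2 * lam) (diffop_eta1 (diffop_d2 Gd))).
have D1 := linear_diff_cochain_mono 1 0 (diffopN (diffop_d2 sGd)).
have D2 := linear_diff_cochain_mono 0 1
  (diffopN (diffopM (th2 R) (diffop_eta2 (diffop_eta1 sGd)))).
apply: linear_diff_cochain_ext
  (linear_diff_cochainD D0 (linear_diff_cochainD D1 D2)) => y H.
by rewrite /Ups_diag /= !mulNr -opprD scalerAl.
Qed.

Lemma Ups_half_cochain k : linear_diff_cochain (@Ups_half R k).
Proof.
have Gd := diffop_id R; have sGd := diffop_stwist Gd.
have D0 := linear_diff_cochain_mono 1 (2 * k - 1)
  (diffopZ k%:R (diffop_eta1 (diffop_d2 Gd))).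
have D1 := linear_diff_cochain_mono 0 (2 * k + 1) (diffopN (diffop_d2 sGd)).
have D2 := linear_diff_cochain_mono (2 * k + 1) 0
  (diffop_eta1 (diffopM (th2 R) (diffop_d2 sGd))).
apply: linear_diff_cochain_ext
  (linear_diff_cochainD D0 (linear_diff_cochainD D1 D2)) => y H.
by rewrite /Ups_half /= mulNr opprB scalerAl [- _ + _]addrC.
Qed.

End DifferentialCochains.

(** * The two families of cocycles *)

Section Cocycles.
Context (R : realType).
Implicit Types (a b c d lam mu : R) (p q r : bool) (n : nat).
Implicit Types (F G H : superfun R) (U : osp22 R -> operator R).
Local Notation X := (cX R).

Lemma Ups_diag_ev lam a b c d H : Ups_diag lam (ev a b c d) H = SuperFun
  (- ((const lam * (const d * s0 H)) *+ 4))
  ((const d * s1 H) *+ 2 - (const lam * (const d * s1 H)) *+ 4)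
  (- ((const d * s2 H) *+ 2) - (const lam * (const d * s2 H)) *+ 4)
  (- ((const lam * (const d * s12 H)) *+ 4)).
Proof.
rewrite /Ups_diag stwistE !(eta1E, eta2E) /d2; apply: superfunP;
  rewrite /= ?scale_const ?constM ?(constD, const1) ?oppr0 ?cDE; gring.
Qed.

Lemma Ups_diag_od lam a b c d H : Ups_diag lam (od a b c d) H = SuperFun
  ((const c * s1 H + const d * (X * s1 H)) *+ 2)
  (- ((const c * cD (s0 H) + const d * (X * cD (s0 H))) *+ 2)
   - (const lam * (const d * s0 H)) *+ 4)
  ((const c * s12 H + const d * (X * s12 H)) *+ 2)
  (- ((const c * cD (s2 H) + const d * (X * cD (s2 H))
      + const d * s2 H) *+ 2) - (const lam * (const d * s2 H)) *+ 4).
Proof.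
rewrite /Ups_diag stwistE !(eta1E, eta2E) /d2; apply: superfunP;
  rewrite /= ?scale_const ?constM ?(constD, const1) ?oppr0 ?cDE; gring.
Qed.

Lemma Ups_half_iter n H :
  [/\ iter (2 * n.+1 - 1) (@eta2 R) H = (-1) ^+ n *: eta2 (dxn n H),
      iter (2 * n.+1 + 1) (@eta2 R) H = - ((-1) ^+ n *: eta2 (dxn n.+1 H)) &
      iter (2 * n.+1 + 1) (@eta1 R) H = - ((-1) ^+ n *: eta1 (dxn n.+1 H))].
Proof.
split.
- have -> : (2 * n.+1 - 1 = (2 * n).+1)%N by rewrite mulnS subn1.
  by rewrite iterS iter_eta2 linearZ.
- by rewrite addn1 iterS iter_eta2 linearZ /= exprS mulN1r scaleNr.
- by rewrite addn1 iterS iter_eta1 linearZ /= exprS mulN1r scaleNr.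
Qed.

Lemma const_natS n : const n.+1%:R = const n%:R + 1 :> Cinf R.
Proof. by rewrite -natr1 constD const1. Qed.

Lemma Ups_half_ev n a b c d H : Ups_half n.+1 (ev a b c d) H =
  SuperFun
    (const ((-1) ^+ n) * (const d * (const n.+1%:R * cDn n (s12 H))) *+ 2)
    (const ((-1) ^+ n) * (const d * (const n%:R * cD (cDn n (s2 H)))) *+ 2)
    (- (const ((-1) ^+ n)
        * (const d * (const n.+2%:R * cD (cDn n (s1 H)))) *+ 2))
    (- (const ((-1) ^+ n)
        * (const d * (const n.+1%:R * cD (cD (cDn n (s0 H))))) *+ 2)).
Proof.
rewrite /Ups_half; have [-> -> ->] := Ups_half_iter n H.
move: ((-1) ^+ n) => e; have E1 := const_natS n; have E2 := const_natS n.+1.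
rewrite stwistE !(eta1E, eta2E) /d2 /dxn !cDnS; apply: superfunP;
  rewrite /= ?scale_const ?E2 ?E1 ?(mul0r, mul1r, mulr0, oppr0, addr0) ?cDE;
  gring.
Qed.

Lemma Ups_half_od n a b c d H : Ups_half n.+1 (od a b c d) H =
  SuperFun
    (- (const ((-1) ^+ n) * (const c * cD (cDn n (s2 H))
       + const d * (X * cD (cDn n (s2 H)))) *+ 2))
    (const ((-1) ^+ n) * (const c * cD (cDn n (s12 H))
       + const d * (X * cD (cDn n (s12 H)))
       + const d * (const n.+1%:R * cDn n (s12 H))) *+ 2)
    (const ((-1) ^+ n) * (const c * cD (cD (cDn n (s0 H)))
       + const d * (X * cD (cD (cDn n (s0 H))))) *+ 2)
    (- (const ((-1) ^+ n) * (const c * cD (cD (cDn n (s1 H)))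
       + const d * (X * cD (cD (cDn n (s1 H))))
       + const d * (const n.+2%:R * cD (cDn n (s1 H)))) *+ 2)).
Proof.
rewrite /Ups_half; have [-> -> ->] := Ups_half_iter n H.
move: ((-1) ^+ n) => e; have E1 := const_natS n; have E2 := const_natS n.+1.
rewrite stwistE !(eta1E, eta2E) /d2 /dxn !cDnS; apply: superfunP;
  rewrite /= ?scale_const ?E2 ?E1 ?(mul0r, mul1r, mulr0, oppr0, addr0) ?cDE;
  gring.
Qed.

(** Equivariance under k is the cocycle identity with one argument in k, where U
    vanishes. The identity for (odd, even) pairs follows from (even, odd) pairs
    by antisymmetry. *)
Lemma is_cocycle_even lam mu U : linear_diff_cochain U ->
  (forall q y t H, osp22_par q y -> spart t H = H ->
     spart (q (+) t) (U y H) = U y H) ->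
  (forall a b c, U (ev a b c 0) = 0) -> (forall a b, U (od a b 0 0) = 0) ->
  (forall q r y z H, q ==> r -> osp22_par q y -> osp22_par r z ->
     Lie mu (gen y) (U z H) - (-1) ^+ (q && r) *: U z (Lie lam (gen y) H)
     - (-1) ^+ (q && r) *: (Lie mu (gen z) (U y H)
        - (-1) ^+ (q && r) *: U y (Lie lam (gen z) H))
     = U (osp22_br y z) H) ->
  is_cocycle lam mu false U.
Proof.
move=> [Ul Ud Uo] Up U0 U1 Uc; have [_ _ UD _] := linear_additive Ul.
have Uk h : osp12 h -> U h = 0.
  by move=> /osp12_decomp[a [b [c [d [e ->]]]]]; rewrite UD U0 U1 addr0.
have Upar q y : osp22_par q y -> diffop q (U y).
  by move=> yq; apply: diffop_par => // t H; exact: Up.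
have Udelta_ordered q r y z : q ==> r -> osp22_par q y -> osp22_par r z ->
    opact lam mu (gen y) (U z) - (-1) ^+ (q && r) *: opact lam mu (gen z) (U y)
    = U (osp22_br y z).
  move=> qr yq zr; apply/funext => H; rewrite -(Uc q r) //.
  rewrite -[LHS]/(_ - _ *: opact lam mu (gen z) (U y) H).
  have [_ yp] := Upar _ _ yq; have [_ zp] := Upar _ _ zr.
  rewrite (opact_hom _ _ _ (diffop_linear (Uo z)) zp yq).
  by rewrite (opact_hom _ _ _ (diffop_linear (Uo y)) yp zr) andbC.
have Udelta q r y z : osp22_par q y -> osp22_par r z ->
    opact lam mu (gen y) (U z) - (-1) ^+ (q && r) *: opact lam mu (gen z) (U y)
    = U (osp22_br y z).
  case: q; case: r => yq zr; try exact: Udelta_ordered.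
  have {Udelta_ordered} := Udelta_ordered false true z y isT zr yq.
  move: yq zr => /par_odP[a [b [c [d ->]]]] /par_evP[a' [b' [c' [d' ->]]]].
  rewrite br_ev_od br_od_ev /= expr0 !scale1r => E.
  rewrite -opprB E; have [_ UN _ _] := linear_additive Ul; rewrite -UN.
  by congr U; apply: val_inj; apply: superfunP; rewrite /= ?constN; gring.
split.
  split=> // q h y hk hq; rewrite andbF expr0 scale1r.
  have [y0 [y1 [y0p y1p ->]]] := par_decomp y.
  have [_ _ brD _] := linear_additive (br_linear h).
  rewrite brD !UD -(Udelta _ _ _ _ hq y0p) -(Udelta _ _ _ _ hq y1p).
  rewrite (Uk h hk) !opact0.
  rewrite !scaler0 !subr0.
  have [_ _ aD _] := linear_additive (opact_linearA lam mu (gen h)).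
  exact/esym/aD.
move=> q r y z yq zr; rewrite andbF expr0 scale1r addbF andbC.
by rewrite -(Udelta q r y z yq zr) subrr.
Qed.

(** With (n+1)/2 as the only parameter, the cocycle identities at
    lam = - (n+1)/2 and mu = (n+1)/2 have integer coefficients. *)
Lemma const_nat_half n :
  const n%:R = const (n.+1%:R / 2) *+ 2 - 1 :> Cinf R.
Proof. by rewrite -constMn halfMn const_natS addrK. Qed.

Ltac expand_derivatives :=
  rewrite ?(cDnMn, cDnN, cDn_const, cDn_XM, cDn_cD, cDnD);
  rewrite ?(cDn'D, cDn'N, cDn'_const, cDn'_XM, cDn'_cD, cDn''_cD);
  rewrite ?(cDMn, cDN, cD_constM, cD_XM, cD_cDn', cD_cDn'', cDD).

Lemma Ups_diag_cocycle lam : is_cocycle lam lam false (Ups_diag lam).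
Proof.
apply: is_cocycle_even; first exact: Ups_diag_cochain.
- move=> [] y [] H /[dup] + _ <-.
  + move=> /par_odP[a [b [c [d ->]]]]; rewrite Ups_diag_od.
    by apply: superfunP; rewrite /spart /= ?cD0 ?(mulr0, addr0, mul0rn, oppr0).
  + move=> /par_odP[a [b [c [d ->]]]]; rewrite Ups_diag_od.
    by apply: superfunP; rewrite /spart /= ?cD0 ?(mulr0, addr0, mul0rn, oppr0).
  + move=> /par_evP[a [b [c [d ->]]]]; rewrite Ups_diag_ev.
    by apply: superfunP; rewrite /spart /= ?cD0 ?(mulr0, addr0, mul0rn, oppr0).
  + move=> /par_evP[a [b [c [d ->]]]]; rewrite Ups_diag_ev.
    by apply: superfunP; rewrite /spart /= ?cD0 ?(mulr0, addr0, mul0rn, oppr0).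
- move=> a b c; apply/funext => H; rewrite Ups_diag_ev; apply: superfunP;
    by rewrite /= const0 ?(mul0r, mulr0, mul0rn, oppr0, addr0).
- move=> a b; apply/funext => H; rewrite Ups_diag_od; apply: superfunP;
    by rewrite /= const0 ?(mul0r, mulr0, mul0rn, oppr0, addr0).
move=> [] [] // y z H _.
- move=> /par_odP[a [b [c [d ->]]]] /par_odP[a' [b' [c' [d' ->]]]].
  rewrite br_od_od !(Ups_diag_ev, Ups_diag_od); rewrite !(Lie_even, Lie_odd);
    rewrite ?expr0 ?expr1 ?scale1r ?scaleN1r; apply: superfunP => /=;
    expand_derivatives; rewrite ?(constD, constN, constM, constMn, const0);
    gring.
- move=> /par_evP[a [b [c [d ->]]]] /par_odP[a' [b' [c' [d' ->]]]].
  rewrite br_ev_od !(Ups_diag_ev, Ups_diag_od); rewrite !(Lie_even, Lie_odd);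
    rewrite ?expr0 ?expr1 ?scale1r ?scaleN1r; apply: superfunP => /=;
    expand_derivatives; rewrite ?(constD, constN, constM, constMn, const0);
    gring.
- move=> /par_evP[a [b [c [d ->]]]] /par_evP[a' [b' [c' [d' ->]]]].
  rewrite br_ev_ev !(Ups_diag_ev, Ups_diag_od); rewrite !(Lie_even, Lie_odd);
    rewrite ?expr0 ?expr1 ?scale1r ?scaleN1r; apply: superfunP => /=;
    expand_derivatives; rewrite ?(constD, constN, constM, constMn, const0);
    gring.
Qed.

Lemma Ups_half_cocycle n :
  is_cocycle (- (n.+1%:R / 2)) (n.+1%:R / 2) false (@Ups_half R n.+1).
Proof.
apply: is_cocycle_even; first exact: Ups_half_cochain.
- move=> [] y [] H /[dup] + _ <-.
  + move=> /par_odP[a [b [c [d ->]]]]; rewrite Ups_half_od.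
    by apply: superfunP; rewrite /spart /=
      ?cDn_0 ?cD0 ?(mulr0, addr0, mul0rn, oppr0).
  + move=> /par_odP[a [b [c [d ->]]]]; rewrite Ups_half_od.
    by apply: superfunP; rewrite /spart /=
      ?cDn_0 ?cD0 ?(mulr0, addr0, mul0rn, oppr0).
  + move=> /par_evP[a [b [c [d ->]]]]; rewrite Ups_half_ev.
    by apply: superfunP; rewrite /spart /=
      ?cDn_0 ?cD0 ?(mulr0, addr0, mul0rn, oppr0).
  + move=> /par_evP[a [b [c [d ->]]]]; rewrite Ups_half_ev.
    by apply: superfunP; rewrite /spart /=
      ?cDn_0 ?cD0 ?(mulr0, addr0, mul0rn, oppr0).
- move=> a b c; apply/funext => H; rewrite Ups_half_ev; apply: superfunP;
    by rewrite /= const0 ?(mul0r, mulr0, mul0rn, oppr0, addr0).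
- move=> a b; apply/funext => H; rewrite Ups_half_od; apply: superfunP;
    by rewrite /= const0 ?(mul0r, mulr0, mul0rn, oppr0, addr0).
have E := const_nat_half n.
move=> [] [] // y z H _.
- move=> /par_odP[a [b [c [d ->]]]] /par_odP[a' [b' [c' [d' ->]]]].
  rewrite br_od_od !(Ups_half_ev, Ups_half_od); rewrite !(Lie_even, Lie_odd);
    rewrite ?expr0 ?expr1 ?scale1r ?scaleN1r; apply: superfunP => /=;
    expand_derivatives; rewrite ?(constD, constN); move: E;
    move: (const (n.+1%:R / 2)) => L E; rewrite ?const_natS ?E;
    rewrite ?(constD, constN, constM, constMn, const0, const1); gring.
- move=> /par_evP[a [b [c [d ->]]]] /par_odP[a' [b' [c' [d' ->]]]].
  rewrite br_ev_od !(Ups_half_ev, Ups_half_od); rewrite !(Lie_even, Lie_odd);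
    rewrite ?expr0 ?expr1 ?scale1r ?scaleN1r; apply: superfunP => /=;
    expand_derivatives; rewrite ?(constD, constN); move: E;
    move: (const (n.+1%:R / 2)) => L E; rewrite ?const_natS ?E;
    rewrite ?(constD, constN, constM, constMn, const0, const1); gring.
- move=> /par_evP[a [b [c [d ->]]]] /par_evP[a' [b' [c' [d' ->]]]].
  rewrite br_ev_ev !(Ups_half_ev, Ups_half_od); rewrite !(Lie_even, Lie_odd);
    rewrite ?expr0 ?expr1 ?scale1r ?scaleN1r; apply: superfunP => /=;
    expand_derivatives; rewrite ?(constD, constN); move: E;
    move: (const (n.+1%:R / 2)) => L E; rewrite ?const_natS ?E;
    rewrite ?(constD, constN, constM, constMn, const0, const1); gring.
Qed.

End Cocycles.

(** * Relative cocycles modulo coboundaries *)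

Section Cohomology.
Context (R : realType).
Implicit Types (a b c d k lam mu : R) (p q : bool) (m n : nat).
Implicit Types (A v : operator R) (U V : osp22 R -> operator R).

(** Up to sign, these A are the lowest weight vectors of coboundaries. *)
Definition theta2_image lam mu p A := exists2 v, rel_invariant lam mu p v &
  opact lam mu (osp_odd 0 0 1 0) v = A.

Lemma theta2_image0 lam mu p : theta2_image lam mu p 0.
Proof. by exists 0; [exact: rel_invariant0|exact: opact0]. Qed.

Lemma theta2_image_lin lam mu p k A A' : theta2_image lam mu p A ->
  theta2_image lam mu p A' -> theta2_image lam mu p (k *: A + A').
Proof.
move=> [v vi vA] [v' vi' vA']; exists (k *: v + v'); first exact: rel_invariant_lin.
by rewrite -vA -vA'; exact: opact_linearA.
Qed.

Lemma theta2_imageZ lam mu p k A : theta2_image lam mu p A ->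
  theta2_image lam mu p (k *: A).
Proof.
by move=> hA; rewrite -[k *: A]addr0; exact: theta2_image_lin (theta2_image0 _ _ _).
Qed.

Lemma theta2_imageD lam mu p A A' : theta2_image lam mu p A ->
  theta2_image lam mu p A' -> theta2_image lam mu p (A + A').
Proof. by move=> hA hA'; rewrite -[A]scale1r; exact: theta2_image_lin. Qed.

Lemma rel_cochain_coboundary lam mu p U : is_rel_cochain lam mu p U ->
  theta2_image lam mu p (U (od 0 0 1 0)) ->
  exists2 v, rel_invariant lam mu p v & U = delta0 lam mu p v.
Proof.
move=> Urel /(theta2_imageZ ((-1) ^+ p)) [v vi vU]; exists v => //.
apply: rel_cochain_delta0 => //.
by rewrite vU scalerA -expr2 sqrr_sign scale1r.
Qed.

Ltac theta2_solve vd :=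
  apply/funext => H;
  rewrite (opact_hom _ _ _ (diffop_linear (vd).1) (vd).2 (od_par 0 0 1 0));
  rewrite !Lie_2th2 ?expr0 ?expr1 ?scale1r ?scaleN1r ?opprK; apply: superfunP;
  rewrite /= ?(cDnMn, cDnN, cDn_cD, cDnS) ?(cDN, cD0) ?(const0, const1, constN);
  gring.

Lemma theta2_id22 lam mu n :
  opact lam mu (osp_odd 0 0 1 0) (@inv_id22 R) = op_odd n 0 0 1.
Proof. theta2_solve (inv_id22_diffop R). Qed.

Lemma theta2_eta12 lam mu n m :
  opact lam mu (osp_odd 0 0 1 0) (@inv_eta12 R n) = op_odd n 1 m 0.
Proof. theta2_solve (inv_eta12_diffop R n). Qed.

Lemma theta2_id12 lam mu m :
  opact lam mu (osp_odd 0 0 1 0) (@inv_id12 R) = op_even 0 1 m 0.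
Proof. theta2_solve (inv_id12_diffop R). Qed.

Lemma theta2_id21 lam mu m :
  opact lam mu (osp_odd 0 0 1 0) (@inv_id21 R) = op_even 1 1 m 0.
Proof. theta2_solve (inv_id21_diffop R). Qed.

Lemma theta2_eta11 lam mu n m :
  opact lam mu (osp_odd 0 0 1 0) (@inv_eta11 R m) = - op_even n 0 m 1.
Proof. theta2_solve (inv_eta11_diffop R m). Qed.

Lemma theta2_eta22 lam mu n m :
  opact lam mu (osp_odd 0 0 1 0) (@inv_eta22 R m) = op_even n 0 m 1.
Proof. theta2_solve (inv_eta22_diffop R m). Qed.

Lemma op_evenE n c m d :
  op_even n c m d = c *: @op_even R n 1 m 0 + d *: op_even n 0 m 1.
Proof.
apply/funext => H; rewrite -[RHS]/(c *: op_even _ _ _ _ H + d *: op_even _ _ _ _ H).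
by apply: superfunP; rewrite /= !scale_const const0 const1; gring.
Qed.

Lemma op_oddE n c m d :
  op_odd n c m d = c *: @op_odd R n 1 m 0 + d *: op_odd n 0 m 1.
Proof.
apply/funext => H; rewrite -[RHS]/(c *: op_odd _ _ _ _ H + d *: op_odd _ _ _ _ H).
by apply: superfunP; rewrite /= !scale_const const0 const1; gring.
Qed.

(** Each constraint on an even B is met by an invariant operator: the term c D^n
    by the identities between the summands, the term in eta_2 eta_1 by the odd
    powers of eta_1. *)
Lemma odd_cocycle_coboundary lam mu U : is_cocycle lam mu true U ->
  exists2 v, rel_invariant lam mu true v & U = delta0 lam mu true v.
Proof.
move=> Uc; apply: rel_cochain_coboundary; first exact: is_cocycle_rel.
have := cocycle_lowest_weight Uc; set B := U _ => Blw.
have [n [c [m [d [nE mE BE]]]]] := lowest_weight_even Blw.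
rewrite BE in Blw *; rewrite op_evenE.
have half e i : (mu - lam) *+ 2 + e = i%:R *+ 2 -> mu = lam + i%:R - e / 2.
  by move=> E; lra.
apply: theta2_imageD.
  have [->|c0] := eqVneq c 0; first by rewrite scale0r; exact: theta2_image0.
  apply: theta2_imageZ; have := op_even_left Blw c0; have := half _ _ (nE c0).
  case: n {BE Blw nE} => [|[|//]] -> _.
    exists (@inv_id12 R); last exact: theta2_id12.
    by rewrite addr0; exact: inv_id12_invariant.
  exists (@inv_id21 R); last exact: theta2_id21.
  rewrite (_ : lam + 1 - 1 / 2 = lam + 1 / 2); first exact: inv_id21_invariant.
  by lra.
have [->|d0] := eqVneq d 0; first by rewrite scale0r; exact: theta2_image0.
apply: theta2_imageZ; have muE := half _ _ (mE d0).
have [lamE|lamE] := op_even_right Blw d0.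
  rewrite -[op_even _ _ _ _]opprK -scaleN1r; apply: theta2_imageZ.
  exists (@inv_eta11 R m); last exact: theta2_eta11.
  rewrite lamE (_ : mu = m%:R / 2 + 1 / 2); first exact: inv_eta11_invariant.
  by rewrite muE lamE; lra.
exists (@inv_eta22 R m); last exact: theta2_eta22.
rewrite lamE (_ : - (m.+1%:R / 2) = - (m%:R / 2 + 1 / 2)); last first.
  by rewrite -natr1; lra.
rewrite (_ : mu = m%:R / 2); first exact: inv_eta22_invariant.
by rewrite muE lamE -natr1; lra.
Qed.

Lemma even_cocycle_image lam mu U : is_cocycle lam mu false U ->
  exists n c m d,
  [/\ c != 0 -> mu - lam = n%:R /\ ((0 < n)%N -> lam = - (n%:R / 2)),
    d != 0 -> mu - lam = m%:R /\ ((0 < m)%N -> lam = - (m%:R / 2)) &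
    U (od 0 0 1 0) = c *: op_odd n 1 m 0 + d *: op_odd n 0 m 1].
Proof.
move=> Uc; have := cocycle_lowest_weight Uc; set B := U _ => Blw.
have [n [c [m [d [nE mE BE]]]]] := lowest_weight_odd Blw.
rewrite BE in Blw *; exists n, c, m, d; rewrite -op_oddE.
have [cE dE] := op_odd_weight Blw.
by split=> // => [c0|d0]; split; [exact: nE|exact: cE|exact: mE|exact: dE].
Qed.

(** Here B = c eta_1 + d eta_2. The projection onto the second summand accounts
    for eta_2. For lam <> 0 the cocycle [Ups_diag] accounts for eta_1; for lam = 0
    the coboundary of an operator built from eta_1 does. *)
Lemma diag_cocycle lam U : is_cocycle lam lam false U ->
  exists a v, [/\ (lam = 0 -> a = 0), rel_invariant lam lam false v &
    - a *: Ups_diag lam + U = delta0 lam lam false v].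
Proof.
move=> Uc; have [n [c [m [d [cE dE UE]]]]] := even_cocycle_image Uc.
have zero (k : nat) : lam - lam = k%:R -> k = 0%N.
  by rewrite subrr => /esym/eqP; rewrite pnatr_eq0 => /eqP.
pose a := if lam == 0 then 0 else c / 2; exists a.
suff [v vi vE] : exists2 v, rel_invariant lam lam false v &
    - a *: Ups_diag lam + U = delta0 lam lam false v.
  by exists v; split=> //; rewrite /a => /eqP ->.
apply: rel_cochain_coboundary.
  by apply: is_rel_cochain_lin; apply: is_cocycle_rel => //; exact: Ups_diag_cocycle.
rewrite -[(_ + _) (od 0 0 1 0)]/(- a *: Ups_diag lam (od 0 0 1 0) + U _) UE.
rewrite addrA; apply: theta2_imageD; last first.
  have [->|/dE[/zero -> _]] := eqVneq d 0.
    by rewrite scale0r; exact: theta2_image0.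
  apply: theta2_imageZ; exists (@inv_id22 R); last exact: theta2_id22.
  exact: inv_id22_invariant.
have Ups0 : Ups_diag lam (od 0 0 1 0) = 2 *: op_odd 0 1 m 0.
  apply/funext => H; rewrite Ups_diag_od -[RHS]/(2 *: op_odd _ _ _ _ H).
  by apply: superfunP; rewrite /= ?scaler_nat ?(const0, const1); gring.
have [c0|/cE[/zero n0 _]] := eqVneq c 0.
  have -> : a = 0 by rewrite /a c0 mul0r if_same.
  by rewrite c0 oppr0 !scale0r addr0; exact: theta2_image0.
rewrite Ups0 n0 /a scalerA -scalerDl; case: eqP => [->|_]; last first.
  rewrite (_ : _ + c = 0) ?scale0r; first exact: theta2_image0.
  by rewrite mulNr divfK ?pnatr_eq0 // addNr.
apply: theta2_imageZ; exists (@inv_eta12 R 0); last exact: theta2_eta12.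
by have := inv_eta12_invariant R 0; rewrite mul0r oppr0.
Qed.

(** Here B = c D^k eta_1 + d D^k eta_2 with k = n + 1. The first term comes from
    a coboundary, the second from [Ups_half]. *)
Lemma half_cocycle n U :
  is_cocycle (- (n.+1%:R / 2)) (n.+1%:R / 2) false U ->
  exists a v, rel_invariant (- (n.+1%:R / 2)) (n.+1%:R / 2) false v /\
    - a *: @Ups_half R n.+1 + U
    = delta0 (- (n.+1%:R / 2)) (n.+1%:R / 2) false v.
Proof.
move=> Uc; have [n' [c [m [d [cE dE UE]]]]] := even_cocycle_image Uc.
have exponent (k : nat) : n.+1%:R / 2 - - (n.+1%:R / 2) = k%:R :> R -> k = n.+1.
  by rewrite opprK -mulr2n halfMn => /eqP; rewrite eqr_nat => /eqP.
(* [Ups_half] takes the value - 2 (-1)^n D^k eta_2 at 2 theta_2 *)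
pose e : R := (-1) ^+ n; pose a := - e * d / 2; exists a.
suff [v vi vE] : exists2 v, rel_invariant (- (n.+1%:R / 2)) (n.+1%:R / 2) false v &
    - a *: @Ups_half R n.+1 + U
    = delta0 (- (n.+1%:R / 2)) (n.+1%:R / 2) false v.
  by exists v.
apply: rel_cochain_coboundary.
  by apply: is_rel_cochain_lin; apply: is_cocycle_rel => //; exact: Ups_half_cocycle.
rewrite -[(_ + _) (od 0 0 1 0)]/(- a *: @Ups_half R n.+1 (od 0 0 1 0) + U _) UE.
rewrite addrCA; apply: theta2_imageD.
  have [->|/cE[/exponent -> _]] := eqVneq c 0.
    by rewrite scale0r; exact: theta2_image0.
  apply: theta2_imageZ; exists (@inv_eta12 R n.+1); last exact: theta2_eta12.
  exact: inv_eta12_invariant.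
have [d0|/dE[/exponent -> _]] := eqVneq d 0.
  have -> : a = 0 by rewrite /a d0 mulr0 mul0r.
  by rewrite d0 oppr0 !scale0r addr0; exact: theta2_image0.
have -> : @Ups_half R n.+1 (od 0 0 1 0) = (- (e *+ 2)) *: op_odd n' 0 n.+1 1.
  apply/funext => H; rewrite Ups_half_od -[RHS]/(_ *: op_odd _ _ _ _ H) -/e.
  by apply: superfunP;
    rewrite /= ?cDnS ?scale_const ?(constN, constMn, const0, const1); gring.
have -> : - a = e * d / 2 by rewrite /a !mulNr opprK.
rewrite scalerA -scalerDl (_ : _ + _ = 0) ?scale0r; first exact: theta2_image0.
have ee : e * e = 1 by rewrite /e -expr2 sqrr_sign.
have -> : e * d / 2 * - (e *+ 2) + d = d - d * (e * e) by field.
by rewrite ee mulr1 subrr.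
Qed.

Lemma generic_cocycle lam mu U : is_cocycle lam mu false U -> lam <> mu ->
  (forall k : nat, (0 < k)%N -> lam = - (k%:R / 2) -> mu = k%:R / 2 -> False) ->
  exists2 v, rel_invariant lam mu false v & U = delta0 lam mu false v.
Proof.
move=> Uc lam_mu not_half.
have [n [c [m [d [cE dE UE]]]]] := even_cocycle_image Uc.
have excluded (k : nat) b :
    (b != 0 -> mu - lam = k%:R /\ ((0 < k)%N -> lam = - (k%:R / 2))) -> b = 0.
  move=> bE; apply/eqP/negPn/negP => /bE[]; case: k {bE} => [|k] muE lamE.
    by apply: lam_mu; apply/esym/eqP; rewrite -subr_eq0 muE.
  by apply: (not_half k.+1); rewrite ?lamE //; move: muE; rewrite lamE //; lra.
apply: rel_cochain_coboundary; first exact: is_cocycle_rel.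
rewrite UE (excluded _ _ cE) (excluded _ _ dE) !scale0r addr0.
exact: theta2_image0.
Qed.

End Cohomology.

(** * The cohomology spaces *)

Section QuotientSpace.
Context (R : realType).
Implicit Types (lam mu a : R) (z c : osp22 R -> operator R).

Lemma Z1_cocycle lam mu c : is_cocycle lam mu false c -> Z1 lam mu c.
Proof.
move=> cc; exists (fun p => if p then 0 else c); split; last first.
  by rewrite big_bool /= add0r.
case=> //; split; first split.
- by move=> k y z; rewrite scaler0 addr0.
- exists 0%N, (fun _ _ _ _ => 0) => G H; by rewrite big_ord0.
- by move=> q y _; have [] := (rel_invariant0 lam mu (true (+) q)).
- by [].
- move=> q h y _ _.
  have -> : opact lam mu (gen h) ((0 : osp22 R -> operator R) y) = 0.
    exact: opact0.
  by rewrite scaler0.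
move=> q r y z _ _.
have E (w : osp22 R) : opact lam mu (gen w) 0 = 0 by exact: opact0.
rewrite -![(0 : osp22 R -> operator R) _]/(0 : operator R) !E.
by rewrite !scaler0 !subr0.
Qed.

Lemma B1_delta0 lam mu v v' : rel_invariant lam mu true v ->
  rel_invariant lam mu false v' ->
  B1 lam mu (delta0 lam mu true v + delta0 lam mu false v').
Proof.
move=> vi vi'; exists (fun p => if p then v else v').
exists (fun p => delta0 lam mu p (if p then v else v')); split.
  case; split.
  - exact: vi.
  - exact: delta0P (diffop_linear vi.1.1).
  - exact: vi'.
  - exact: delta0P (diffop_linear vi'.1.1).
by rewrite big_bool.
Qed.

Lemma B1_lin lam mu a z z' : B1 lam mu z -> B1 lam mu z' ->
  B1 lam mu (a *: z + z').
Proof.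
move=> [v [U [vU ->]]] [v' [U' [vU' ->]]].
exists (fun p => a *: v p + v' p), (fun p => a *: U p + U' p); split; last first.
  by rewrite scaler_sumr -big_split.
move=> p; have [vi [Ul UE]] := vU p; have [vi' [Ul' UE']] := vU' p.
split; first exact: rel_invariant_lin.
split.
  move=> k x y; rewrite -![(a *: U p + U' p) _]/(a *: U p _ + U' p _) Ul Ul'.
  move: (U p x) (U p y) (U' p x) (U' p y) => u w u' w'.
  by rewrite !scalerDr !scalerA [k * a]mulrC addrACA.
move=> q y yq; rewrite -[LHS]/(a *: U p y + U' p y) (UE q) // (UE' q) //.
have -> : opact lam mu (gen y) (a *: v p + v' p)
    = a *: opact lam mu (gen y) (v p) + opact lam mu (gen y) (v' p).
  exact: opact_linearA.
move: (opact _ _ _ (v p)) (opact _ _ _ (v' p)) ((-1) ^+ _) => u w e.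
by rewrite scalerDr !scalerA mulrC.
Qed.

Lemma B1_0 lam mu : B1 lam mu 0.
Proof.
have := B1_delta0 (rel_invariant0 lam mu true) (rel_invariant0 lam mu false).
by rewrite !delta0_0 addr0.
Qed.

(** The odd part of a cocycle is a coboundary, so c only has to account for the
    even part. *)
Lemma Z1_mod_B1 lam mu c z :
  (forall U, is_cocycle lam mu false U -> exists a v,
     rel_invariant lam mu false v /\ - a *: c + U = delta0 lam mu false v) ->
  Z1 lam mu z -> exists a, B1 lam mu (z - a *: c).
Proof.
move=> hc [U [Uc ->]]; rewrite big_bool /=.
have [v vi ->] := odd_cocycle_coboundary (Uc true).
have [a [v' [vi' E]]] := hc _ (Uc false); exists a.
by rewrite -addrA [_ - a *: c]addrC -scaleNr E; exact: B1_delta0.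
Qed.

(** One generating class gives dimension 0 or 1, according to whether it is
    trivial. *)
Lemma quotient_dim_generated lam mu c : class_generates (Z1 lam mu) (B1 lam mu) c ->
  exists2 n : nat, (n <= 1)%N & dimH1 lam mu n.
Proof.
move=> [Zc gen_c]; have [Bc|nBc] := pselect (B1 lam mu c).
  exists 0%N => //; exists (fun _ => 0); split=> [[]//|a _ []//|z /gen_c[a Ba]].
  exists (fun _ => 0); rewrite big_ord0 subr0.
  by rewrite -(subrK (a *: c) z) addrC; exact: B1_lin.
exists 1%N => //; exists (fun _ => c); split=> // [a|z /gen_c[a Ba]]; last first.
  by exists (fun _ => a); rewrite big_ord1.
rewrite big_ord1 => Bac i; rewrite ord1; apply/eqP/negPn/negP => a0; apply: nBc.
have := B1_lin (a ord0)^-1 Bac (B1_0 lam mu).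
by rewrite addr0 scalerA mulVf // scale1r.
Qed.

End QuotientSpace.

Theorem theorem4p5 (R : realType) (lam mu : R) :
  [/\ (exists2 n : nat, (n <= 1)%N & dimH1 lam mu n),
      (dimH1 lam mu 1 ->
         (lam = mu /\ lam <> 0)
         \/ (exists2 k : nat, (0 < k)%N
               & lam = - (k%:R / 2) /\ mu = k%:R / 2)),
      (lam = mu -> lam <> 0 ->
         class_generates (Z1 lam mu) (B1 lam mu) (Ups_diag lam)) &
      (forall k : nat, (0 < k)%N -> lam = - (k%:R / 2) -> mu = k%:R / 2 ->
         class_generates (Z1 lam mu) (B1 lam mu) (@Ups_half R k))].
Proof.
have diag : lam = mu -> class_generates (Z1 lam mu) (B1 lam mu) (Ups_diag lam).
  move=> <-; split; first exact: Z1_cocycle (Ups_diag_cocycle lam).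
  by move=> z; apply: Z1_mod_B1 => U /diag_cocycle[a [v [_ vi E]]]; exists a, v.
have half (k : nat) : (0 < k)%N -> lam = - (k%:R / 2) -> mu = k%:R / 2 ->
    class_generates (Z1 lam mu) (B1 lam mu) (@Ups_half R k).
  case: k => // n _ -> ->; split; first exact: Z1_cocycle (Ups_half_cocycle R n).
  by move=> z; apply: Z1_mod_B1 => U /half_cocycle.
pose listed := (lam = mu /\ lam <> 0) \/
  (exists2 k : nat, (0 < k)%N & lam = - (k%:R / 2) /\ mu = k%:R / 2).
have trivial : ~ listed -> forall z, Z1 lam mu z -> B1 lam mu z.
  move=> nl z Zz; suff [a] : exists a, B1 lam mu (z - a *: 0).
    by rewrite scaler0 subr0.
  apply: Z1_mod_B1 Zz => U Uc; exists 0; rewrite scaler0 add0r.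
  have [E|lam_mu] := eqVneq lam mu.
    move: nl Uc; rewrite -E => nl /diag_cocycle[a [v [a0 vi UE]]].
    exists v; split=> //; rewrite -UE a0; first by rewrite oppr0 scale0r add0r.
    by apply: contrapT => lam0; apply: nl; left.
  have [|k k0 lamE muE|v vi UE] := generic_cocycle Uc; first exact/eqP.
    by apply: nl; right; exists k.
  by exists v.
split=> //; first 1 last.
- move=> [c [cZ cfree _]]; apply: contrapT => nl.
  have /cfree/(_ ord0) : B1 lam mu (\sum_(i < 1) (fun _ => 1) i *: c i).
    by rewrite big_ord1 scale1r; exact: trivial.
  by move/eqP; rewrite oner_eq0.
- by move=> E _; exact: diag.
have [[[E _]|[k k0 [lamE muE]]]|nl] := pselect listed.
- exact: quotient_dim_generated (diag E).
- exact: quotient_dim_generated (half k k0 lamE muE).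
exists 0%N => //; exists (fun _ => 0); split=> [[]//|a _ []//|z /(trivial nl) Bz].
by exists (fun _ => 0); rewrite big_ord0 subr0.
Qed.
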